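(* Let $T$ be an unbounded non-negative self-adjoint operator in $\mathcal{H}$. Then there are infinitely many pairs $\langle T_1,T_2\rangle$ of unbounded non-negative self-adjoint operators in $\mathcal{H}$ such that (1) $\operatorname{dom}T_1^{1/2}\cap\operatorname{dom}T=\operatorname{dom}T_2^{1/2}\cap\operatorname{dom}T=\{0\}$; (2) for $k=1,2$: $\operatorname{dom}T_k^{1/2}\subset\operatorname{dom}T^{1/2}$ and $\|T_k^{1/2}g\|=\|T^{1/2}g\|$ for all $g\in\operatorname{dom}T_k^{1/2}$; (3) $\operatorname{dom}T_1^{1/2}\cap\operatorname{dom}T_2^{1/2}=\{0\}$; (4) $\operatorname{dom}T^{1/2}=\operatorname{dom}T_1^{1/2}\dotplus\operatorname{dom}T_2^{1/2}$, and $\operatorname{dom}T_1^{1/2}$ and $\operatorname{dom}T_2^{1/2}$ are mutually orthogonal with respect to the inner product $(f,g)_{T^{1/2}}:=(T^{1/2}f,T^{1/2}g)+(f,g)$ on $\operatorname{dom}T^{1/2}$.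
   Context: $\mathcal{H}$ is a complex, infinite-dimensional, separable Hilbert space. $\dotplus$ denotes a direct (algebraic) sum of linear manifolds with trivial intersection. $\operatorname{dom}T^{1/2}$ equipped with $(\cdot,\cdot)_{T^{1/2}}$ is a Hilbert space (the form domain of $T$). *)

(* Defs.v *)
From Stdlib Require Import Reals List.
Open Scope R_scope.
Set Implicit Arguments.

Record C := mkC { Re : R ; Im : R }.
Definition C0 : C := mkC 0 0.
Definition C1 : C := mkC 1 0.
Definition Cadd (a b : C) : C := mkC (Re a + Re b) (Im a + Im b).
Definition Cmul (a b : C) : C :=
  mkC (Re a * Re b - Im a * Im b) (Re a * Im b + Im a * Re b).
Definition Cconj (a : C) : C := mkC (Re a) (- Im a).

Record PreHilbert := {
  car :> Type;
  vzero : car;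
  vadd : car -> car -> car;
  vopp : car -> car;
  vscal : C -> car -> car;
  inner : car -> car -> C;
  vadd_assoc : forall x y z, vadd x (vadd y z) = vadd (vadd x y) z;
  vadd_comm : forall x y, vadd x y = vadd y x;
  vadd_zero : forall x, vadd x vzero = x;
  vadd_opp : forall x, vadd x (vopp x) = vzero;
  vscal_one : forall x, vscal C1 x = x;
  vscal_assoc : forall a b x, vscal a (vscal b x) = vscal (Cmul a b) x;
  vscal_distr_v : forall a x y, vscal a (vadd x y) = vadd (vscal a x) (vscal a y);
  vscal_distr_s : forall a b x, vscal (Cadd a b) x = vadd (vscal a x) (vscal b x);
  inner_conj : forall x y, inner y x = Cconj (inner x y);
  inner_add_l : forall x y z, inner (vadd x y) z = Cadd (inner x z) (inner y z);
  inner_scal_l : forall a x y, inner (vscal a x) y = Cmul a (inner x y);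
  inner_pos : forall x, 0 <= Re (inner x x);
  inner_def : forall x, inner x x = C0 -> x = vzero
}.

Arguments vzero {p}.
Arguments vadd {p}.
Arguments vopp {p}.
Arguments vscal {p}.
Arguments inner {p}.

Section Hdefs.
Variable H : PreHilbert.

Definition vnorm (x : H) : R := sqrt (Re (inner x x)).
Definition vdist (x y : H) : R := vnorm (vadd x (vopp y)).

Definition cauchy (u : nat -> H) : Prop :=
  forall eps, 0 < eps -> exists N, forall n m, (N <= n)%nat -> (N <= m)%nat ->
    vdist (u n) (u m) < eps.
Definition converges_to (u : nat -> H) (l : H) : Prop :=
  forall eps, 0 < eps -> exists N, forall n, (N <= n)%nat -> vdist (u n) l < eps.
Definition complete : Prop :=
  forall u, cauchy u -> exists l, converges_to u l.

Definition dense (A : H -> Prop) : Prop :=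
  forall x eps, 0 < eps -> exists y, A y /\ vdist x y < eps.
Definition separable : Prop :=
  exists d : nat -> H, dense (fun y => exists n, y = d n).

Fixpoint lincomb (cs : list C) (l : list H) : H :=
  match cs, l with
  | c :: cs', v :: l' => vadd (vscal c v) (lincomb cs' l')
  | _, _ => vzero
  end.
Definition finite_dimensional : Prop :=
  exists l : list H, forall x : H,
    exists cs : list C, length cs = length l /\ x = lincomb cs l.
Definition infinite_dimensional : Prop := ~ finite_dimensional.

Record op := { dom : H -> Prop ; ap : H -> H }.

Definition linear_op (T : op) : Prop :=
  dom T vzero /\
  (forall x y, dom T x -> dom T y -> dom T (vadd x y) /\
       ap T (vadd x y) = vadd (ap T x) (ap T y)) /\
  (forall a x, dom T x -> dom T (vscal a x) /\ ap T (vscal a x) = vscal a (ap T x)).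

(* T = T^* : graph of the adjoint equals the graph of T *)
Definition self_adjoint (T : op) : Prop :=
  linear_op T /\ dense (dom T) /\
  forall y z : H,
    (forall x, dom T x -> inner (ap T x) y = inner x z) <->
    (dom T y /\ z = ap T y).

Definition nonneg (T : op) : Prop :=
  forall x, dom T x -> 0 <= Re (inner (ap T x) x).

Definition bounded (T : op) : Prop :=
  exists M : R, forall x, dom T x -> vnorm (ap T x) <= M * vnorm x.
Definition unbounded (T : op) : Prop := ~ bounded T.

Definition nonneg_self_adjoint (T : op) : Prop := self_adjoint T /\ nonneg T.

(* S is the (unique) non-negative self-adjoint square root T^{1/2} of T:
   S nonneg self-adjoint and S S = T as operators (with natural domain). *)
Definition is_sqrt (S T : op) : Prop :=
  nonneg_self_adjoint S /\
  (forall x, dom T x <-> (dom S x /\ dom S (ap S x))) /\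
  (forall x, dom T x -> ap T x = ap S (ap S x)).

Definition op_eq (A B : op) : Prop :=
  (forall x, dom A x <-> dom B x) /\ (forall x, dom A x -> ap A x = ap B x).

End Hdefs.

Arguments dom {H}.
Arguments vnorm {H}.
Arguments vdist {H}.
Arguments ap {H}.

(* Main.v *)
Require Import Defs.
From Stdlib Require Import Reals List Lra Lia Classical IndefiniteDescription ProofIrrelevance Cantor.
Open Scope R_scope.

(* Work in the form domain X = dom T^{1/2}, a Hilbert space for (f,g)_{T^{1/2}} in which dom T
   is dense and each d in dom T gives a functional (.,d) continuous for the weaker norm of H. As
   T is unbounded, the norm of H can be made arbitrarily small relative to that of X on any
   finite-codimensional part of dom T, so Gram-Schmidt yields an orthonormal basis (a_{j,n}),
   (b_{j,n}) of X, inside dom T, along which the coefficients of every element of dom T decay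
   like 2^{-(n+1)^2} for each fixed j. Let Z be the symmetric matrix with entries
   2^{-(n+1)(m+1)}. If x is a bounded sequence and Z x decays that fast, then x = 0: the first
   nonzero entry x_p would give (Z x)_n the exact order 2^{-(n+1)(p+1)}. Hence for every s > 0
   the subspace M_s orthogonal to all the b_{j,n} - s sum_m Z_{nm} a_{j,m}, which contains all
   the a_{j,n} + s sum_m Z_{nm} b_{j,m}, meets dom T only in 0, and so does its orthogonal
   complement in X.

   Each closed subspace M of X with these two properties is dense in H, and it is dom T_1^{1/2}
   for the operator T_1 = R^{-1} - 1, where R is the compression of (1+T)^{-1} to M; the square
   root of T_1 is (1-R)^{1/2} R^{-1/2}. *)

Notation "x +v y" := (vadd x y) (at level 50, left associativity).
Notation "x -v y" := (vadd x (vopp y)) (at level 50, left associativity).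
Notation "a *v x" := (vscal (mkC a 0) x) (at level 40, left associativity).

(** From here on [X] is handled as a real inner product space with the isometry [J], multiplication
    by i; imaginary parts come back through [ri x (J y)]. *)
Definition ri {X : PreHilbert} (x y : X) : R := Re (inner x y).
Definition J {X : PreHilbert} (x : X) : X := vscal (mkC 0 1) x.

Lemma C_ext (a b : Defs.C) : Re a = Re b -> Im a = Im b -> a = b.
Proof. destruct a, b; simpl; intros; subst; reflexivity. Qed.

Lemma CV_const (c : R) : Un_cv (fun _ => c) c.
Proof. intros eps He. exists 0%nat. intros n _. rewrite Rdist_eq. exact He. Qed.

(** * Real inner product and norm *)

Section RealInner.
Variable X : PreHilbert.
Implicit Types (x y z : X) (a b : R).

Lemma ri_sym x y : ri x y = ri y x.
Proof. unfold ri. rewrite (inner_conj X y x). reflexivity. Qed.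

Lemma ri_add_l x y z : ri (x +v y) z = ri x z + ri y z.
Proof. unfold ri. rewrite inner_add_l. reflexivity. Qed.

Lemma ri_add_r x y z : ri z (x +v y) = ri z x + ri z y.
Proof. rewrite !(ri_sym z). apply ri_add_l. Qed.

Lemma ri_zero_l z : ri vzero z = 0.
Proof.
  assert (E : ri (vzero +v vzero) z = ri vzero z) by (rewrite vadd_zero; reflexivity).
  rewrite ri_add_l in E. lra.
Qed.

Lemma ri_zero_r z : ri z vzero = 0.
Proof. rewrite ri_sym. apply ri_zero_l. Qed.

Lemma ri_opp_l x z : ri (vopp x) z = - ri x z.
Proof.
  assert (E : ri (x -v x) z = 0) by (rewrite vadd_opp; apply ri_zero_l).
  rewrite ri_add_l in E. lra.
Qed.

Lemma ri_opp_r x z : ri z (vopp x) = - ri z x.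
Proof. rewrite !(ri_sym z). apply ri_opp_l. Qed.

Lemma ri_scal_l a x z : ri (a *v x) z = a * ri x z.
Proof. unfold ri. rewrite inner_scal_l. simpl. ring. Qed.

Lemma ri_scal_r a x z : ri z (a *v x) = a * ri z x.
Proof. rewrite !(ri_sym z). apply ri_scal_l. Qed.

Lemma ri_J_l x y : ri (J x) y = - Im (inner x y).
Proof. unfold ri, J. rewrite inner_scal_l. simpl. ring. Qed.

Lemma ri_J_r x y : ri x (J y) = Im (inner x y).
Proof. rewrite ri_sym, ri_J_l, (inner_conj X x y). simpl. ring. Qed.

Lemma ri_J x y : ri (J x) y = - ri x (J y).
Proof. rewrite ri_J_l, ri_J_r. reflexivity. Qed.

Lemma inner_ri x y : inner x y = mkC (ri x y) (ri x (J y)).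
Proof. rewrite ri_J_r. unfold ri. destruct (inner x y); reflexivity. Qed.

Lemma ri_pos x : 0 <= ri x x.
Proof. apply inner_pos. Qed.

Lemma ri_J_self x : ri x (J x) = 0.
Proof. pose proof (ri_J x x). rewrite ri_sym in H. lra. Qed.

Lemma ri_def x : ri x x = 0 -> x = vzero.
Proof.
  intro E. apply inner_def. rewrite inner_ri, E, ri_J_self. reflexivity.
Qed.

Lemma vext x y : (forall z, ri x z = ri y z) -> x = y.
Proof.
  intro E.
  assert (D : x -v y = vzero).
  { apply ri_def. rewrite ri_add_l, ri_opp_l, E. ring. }
  assert (Q : vopp y +v y = vzero) by (rewrite vadd_comm; apply vadd_opp).
  rewrite <- (vadd_zero _ x), <- Q, vadd_assoc, D, vadd_comm. apply vadd_zero.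
Qed.

Lemma ri_J_J x y : ri (J x) (J y) = ri x y.
Proof.
  rewrite ri_J. unfold J. rewrite vscal_assoc.
  replace (Cmul (mkC 0 1) (mkC 0 1)) with (mkC (-1) 0) by (apply C_ext; simpl; ring).
  rewrite ri_scal_r. ring.
Qed.

Lemma vscal_ri (c : Defs.C) x z : ri (vscal c x) z = Re c * ri x z + Im c * ri (J x) z.
Proof.
  rewrite ri_J_l. unfold ri. rewrite inner_scal_l. simpl. ring.
Qed.

End RealInner.

Create HintDb ri.
#[export] Hint Rewrite ri_add_l ri_add_r ri_opp_l ri_opp_r ri_scal_l ri_scal_r
  ri_zero_l ri_zero_r : ri.

(* Reduces an equation between vectors to a linear identity between real numbers. *)
Ltac vec := apply vext; intro; autorewrite with ri; try lra; try ring.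

(** * Norm estimates and convergence of sequences *)

Section Norm.
Variable X : PreHilbert.
Implicit Types (x y z : X) (a b : R).

Lemma vnorm_pos x : 0 <= vnorm x.
Proof. apply sqrt_pos. Qed.

Lemma vnorm_sq x : vnorm x * vnorm x = ri x x.
Proof. apply sqrt_sqrt, ri_pos. Qed.

Lemma vnorm_le x b : 0 <= b -> ri x x <= b * b -> vnorm x <= b.
Proof.
  intros Hb E. unfold vnorm. rewrite <- (sqrt_square b) by assumption. apply sqrt_le_1_alt, E.
Qed.

Lemma vnorm_eq x b : 0 <= b -> ri x x = b * b -> vnorm x = b.
Proof. intros Hb E. unfold vnorm. fold (ri x x). rewrite E. apply sqrt_square, Hb. Qed.

Lemma cauchy_schwarz x y : ri x y <= vnorm x * vnorm y.
Proof.
  pose proof (vnorm_pos x). pose proof (vnorm_pos y).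
  pose proof (vnorm_sq x). pose proof (vnorm_sq y).
  assert (E : forall a b, 0 <= a * a * ri x x - 2 * a * b * ri x y + b * b * ri y y).
  { intros a b. pose proof (ri_pos X (a *v x -v b *v y)) as P.
    autorewrite with ri in P. rewrite (ri_sym X y x) in P. lra. }
  (* The coefficients [vnorm y] and [vnorm x] say nothing when a norm vanishes; there a large
     multiple of the null vector contradicts positivity. *)
  destruct (Req_dec (vnorm x * vnorm y) 0) as [Z|Z].
  - destruct (Rle_or_lt (ri x y) 0) as [N|N]; [lra|].
    destruct (Rmult_integral _ _ Z) as [Zx|Zy].
    + specialize (E ((ri y y + 1) / ri x y) 1).
      replace (2 * ((ri y y + 1) / ri x y) * 1 * ri x y) with (2 * (ri y y + 1)) in E by (field; lra).
      assert (ri x x = 0) by nra. rewrite H3 in E. pose proof (ri_pos X y). lra.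
    + specialize (E 1 ((ri x x + 1) / ri x y)).
      replace (2 * 1 * ((ri x x + 1) / ri x y) * ri x y) with (2 * (ri x x + 1)) in E by (field; lra).
      assert (ri y y = 0) by nra. rewrite H3 in E. pose proof (ri_pos X x). lra.
  - specialize (E (vnorm y) (vnorm x)). rewrite <- H1, <- H2 in E.
    assert (0 < vnorm x * vnorm y) by nra. nra.
Qed.

Lemma cauchy_schwarz_abs x y : Rabs (ri x y) <= vnorm x * vnorm y.
Proof.
  apply Rabs_le. split; [|apply cauchy_schwarz].
  pose proof (cauchy_schwarz (vopp x) y) as P. rewrite ri_opp_l in P.
  replace (vnorm (vopp x)) with (vnorm x) in P; [lra|].
  symmetry. apply vnorm_eq; [apply vnorm_pos|]. rewrite ri_opp_l, ri_opp_r, vnorm_sq. ring.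
Qed.

Lemma vnorm_add x y : vnorm (x +v y) <= vnorm x + vnorm y.
Proof.
  pose proof (vnorm_pos x). pose proof (vnorm_pos y).
  apply vnorm_le; [lra|]. autorewrite with ri. rewrite (ri_sym X y x).
  pose proof (cauchy_schwarz x y). pose proof (vnorm_sq x). pose proof (vnorm_sq y). nra.
Qed.

Lemma vnorm_scal a x : vnorm (a *v x) = Rabs a * vnorm x.
Proof.
  apply vnorm_eq.
  - apply Rmult_le_pos; [apply Rabs_pos|apply vnorm_pos].
  - autorewrite with ri. rewrite <- vnorm_sq.
    transitivity ((a * a) * (vnorm x * vnorm x)); [ring|].
    rewrite <- (Rabs_pos_eq (a * a)) by nra. rewrite Rabs_mult. ring.
Qed.

Lemma vnorm_opp x : vnorm (vopp x) = vnorm x.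
Proof. apply vnorm_eq; [apply vnorm_pos|]. autorewrite with ri. rewrite vnorm_sq. ring. Qed.

Lemma vnorm_J x : vnorm (J x) = vnorm x.
Proof. apply vnorm_eq; [apply vnorm_pos|]. rewrite ri_J_J, vnorm_sq. ring. Qed.

Lemma vnorm_sub x y : vnorm (x -v y) <= vnorm x + vnorm y.
Proof. rewrite <- (vnorm_opp y). apply vnorm_add. Qed.

Lemma vnorm_sym x y : vnorm (x -v y) = vnorm (y -v x).
Proof. rewrite <- vnorm_opp. f_equal. vec. Qed.

Lemma vnorm_tri x y z : vnorm (x -v z) <= vnorm (x -v y) + vnorm (y -v z).
Proof. replace (x -v z) with ((x -v y) +v (y -v z)) by vec. apply vnorm_add. Qed.

Lemma vnorm_zero : vnorm (vzero : X) = 0.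
Proof. apply vnorm_eq; [lra|]. rewrite ri_zero_l. ring. Qed.

Lemma sub_zero x y : x -v y = vzero -> x = y.
Proof. intro E. replace x with ((x -v y) +v y) by vec. rewrite E. vec. Qed.

Lemma cv_ri (u : nat -> X) l z : converges_to X u l -> Un_cv (fun n => ri (u n) z) (ri l z).
Proof.
  intros E eps He. pose proof (vnorm_pos z).
  destruct (E (eps / (vnorm z + 1))) as [N HN]; [apply Rdiv_lt_0_compat; lra|].
  exists N. intros n Hn. specialize (HN n Hn). unfold vdist in HN. unfold Rdist.
  replace (ri (u n) z - ri l z) with (ri (u n -v l) z) by (autorewrite with ri; ring).
  eapply Rle_lt_trans; [apply cauchy_schwarz_abs|]. pose proof (vnorm_pos (u n -v l)).
  apply Rle_lt_trans with (vnorm (u n -v l) * (vnorm z + 1)); [nra|].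
  apply (Rmult_lt_compat_r (vnorm z + 1)) in HN; [|lra].
  replace (eps / (vnorm z + 1) * (vnorm z + 1)) with eps in HN by (field; lra). exact HN.
Qed.

Lemma cv_eq (u : nat -> X) l m : converges_to X u l -> converges_to X u m -> l = m.
Proof.
  intros A B. apply vext. intro z. eapply UL_sequence; apply cv_ri; eassumption.
Qed.

Lemma cv_add (u v : nat -> X) l m :
  converges_to X u l -> converges_to X v m -> converges_to X (fun n => u n +v v n) (l +v m).
Proof.
  intros A B eps He. destruct (A (eps / 2)) as [N HN]; [lra|]. destruct (B (eps / 2)) as [M HM]; [lra|].
  exists (N + M)%nat. intros n Hn. unfold vdist in *.
  specialize (HN n ltac:(lia)). specialize (HM n ltac:(lia)).
  replace (u n +v v n -v (l +v m)) with ((u n -v l) +v (v n -v m)) by vec.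
  eapply Rle_lt_trans; [apply vnorm_add|]. lra.
Qed.

Lemma cv_lip (Y : PreHilbert) (u : nat -> X) l (f : X -> Y) c :
  (forall x y, vnorm (f x -v f y) <= c * vnorm (x -v y)) ->
  converges_to X u l -> converges_to Y (fun n => f (u n)) (f l).
Proof.
  intros L A eps He. set (k := Rabs c + 1).
  assert (Hk : 0 < k) by (unfold k; pose proof (Rabs_pos c); lra).
  destruct (A (eps / k)) as [N HN]; [apply Rdiv_lt_0_compat; lra|].
  exists N. intros n Hn. specialize (HN n Hn). unfold vdist in *.
  eapply Rle_lt_trans; [apply L|]. pose proof (vnorm_pos (u n -v l)).
  apply Rle_lt_trans with (k * vnorm (u n -v l)).
  - apply Rmult_le_compat_r; [assumption|]. unfold k. pose proof (Rle_abs c). lra.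
  - replace eps with (k * (eps / k)) by (field; lra). apply Rmult_lt_compat_l; lra.
Qed.

Lemma cv_norm_le (u : nat -> X) l b :
  converges_to X u l -> (exists N, forall n, (N <= n)%nat -> vnorm (u n) <= b) -> vnorm l <= b.
Proof.
  intros A [N HN]. apply le_epsilon. intros eps He. destruct (A eps He) as [M HM].
  specialize (HN (N + M)%nat ltac:(lia)). specialize (HM (N + M)%nat ltac:(lia)). unfold vdist in HM.
  replace l with (u (N + M)%nat -v (u (N + M)%nat -v l)) by vec.
  eapply Rle_trans; [apply vnorm_sub|]. lra.
Qed.

Lemma cv_cauchy (u : nat -> X) l : converges_to X u l -> cauchy X u.
Proof.
  intros A eps He. destruct (A (eps / 2)) as [N HN]; [lra|]. exists N. intros n m Hn Hm.
  pose proof (HN n Hn). pose proof (HN m Hm). unfold vdist in *.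
  rewrite (vnorm_sym (u m)) in H0. eapply Rle_lt_trans; [apply (vnorm_tri _ l)|]. lra.
Qed.

Lemma cauchy_lip (Y : PreHilbert) (u : nat -> X) (v : nat -> Y) c : 0 <= c ->
  (forall n m, vnorm (v n -v v m) <= c * vnorm (u n -v u m)) -> cauchy X u -> cauchy Y v.
Proof.
  intros Hc L A eps He.
  destruct (A (eps / (c + 1))) as [N HN]; [apply Rdiv_lt_0_compat; lra|].
  exists N. intros n m Hn Hm. specialize (HN n m Hn Hm). unfold vdist in *.
  eapply Rle_lt_trans; [apply L|]. pose proof (vnorm_pos (u n -v u m)).
  apply Rle_lt_trans with ((c + 1) * vnorm (u n -v u m)); [nra|].
  replace eps with ((c + 1) * (eps / (c + 1))) by (field; lra). apply Rmult_lt_compat_l; lra.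
Qed.

Lemma small_inv (eps : R) : 0 < eps -> exists N, forall n, (N <= n)%nat -> / INR (S n) < eps.
Proof.
  intro He. destruct (archimed_cor1 eps He) as [N [HN HP]]. exists N. intros n Hn.
  eapply Rle_lt_trans; [|apply HN]. apply Rinv_le_contravar; [apply lt_0_INR; lia|apply le_INR; lia].
Qed.

Lemma dense_seq (W : X -> Prop) x : dense X W -> exists u, (forall n, W (u n)) /\ converges_to X u x.
Proof.
  intro D.
  destruct (functional_choice (fun n y => W y /\ vdist x y < / INR (S n))) as [u Hu].
  { intro n. apply D. apply Rinv_0_lt_compat, lt_0_INR. lia. }
  exists u. split; [intro; apply Hu|]. intros eps He. destruct (small_inv eps He) as [N HN].
  exists N. intros n Hn. unfold vdist. rewrite vnorm_sym. eapply Rlt_trans; [apply Hu|]. apply HN, Hn.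
Qed.

End Norm.

(** * Orthogonal projection *)

Definition subsp {X : PreHilbert} (M : X -> Prop) : Prop :=
  M vzero /\ (forall x y, M x -> M y -> M (x +v y)) /\ (forall c x, M x -> M (vscal c x)).
Definition closed {X : PreHilbert} (M : X -> Prop) : Prop :=
  forall u l, (forall n, M (u n)) -> converges_to X u l -> M l.
Definition orth {X : PreHilbert} (M : X -> Prop) (x : X) : Prop :=
  forall m, M m -> ri x m = 0.

Section Projection.
Variable X : PreHilbert.
Implicit Types (M : X -> Prop).

Lemma subsp_opp M x : subsp M -> M x -> M (vopp x).
Proof. intros S E. replace (vopp x) with ((-1) *v x) by vec. apply S, E. Qed.

Lemma subsp_sub M x y : subsp M -> M x -> M y -> M (x -v y).
Proof. intros S E F. apply S; [|apply subsp_opp]; assumption. Qed.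

Lemma orth_closed M : closed (orth M).
Proof.
  intros u l Hu C m Hm. eapply UL_sequence; [apply cv_ri, C|].
  intros eps He. exists 0%nat. intros n _. rewrite (Hu n m Hm), Rdist_eq. exact He.
Qed.

Lemma orth_subsp M : subsp M -> subsp (orth M).
Proof.
  intro S. split; [|split].
  - intros m _. apply ri_zero_l.
  - intros x y Hx Hy m Hm. rewrite ri_add_l, Hx, Hy by assumption. ring.
  - intros c x Hx m Hm. rewrite vscal_ri, ri_J, !Hx; [ring| |assumption]. apply S, Hm.
Qed.

(** A minimising sequence for the distance from [x] to [M] is Cauchy by the parallelogram law, and
    at its limit the first-order variation along each [m] must vanish. *)
Lemma projection M x : complete X -> subsp M -> closed M -> exists p, M p /\ orth M (x -v p).
Proof.
  intros HC S HM.
  (* Only suprema are given, so the squared distance [d] is minus the supremum of the negated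
     squares. *)
  destruct (completeness (fun r => exists m, M m /\ r = - ri (x -v m) (x -v m))) as [g [Ub Lub]].
  { exists 0. intros r [m [_ ->]]. pose proof (ri_pos X (x -v m)). lra. }
  { exists (- ri (x -v vzero) (x -v vzero)), vzero. split; [apply S|reflexivity]. }
  set (d := - g).
  assert (Hd : forall m, M m -> d <= ri (x -v m) (x -v m)).
  { intros m Hm. specialize (Ub _ (ex_intro _ m (conj Hm eq_refl))). unfold d. lra. }
  assert (Hx : forall n, exists m, M m /\ ri (x -v m) (x -v m) <= d + / INR (Datatypes.S n)).
  { intro n. apply NNPP. intro Hn. assert (0 < / INR (Datatypes.S n)) by (apply Rinv_0_lt_compat, lt_0_INR; lia).
    assert (g <= g - / INR (Datatypes.S n)); [|lra]. apply Lub. intros r [m [Hm ->]].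
    apply Rnot_lt_le. intro L. apply Hn. exists m. split; [assumption|]. unfold d. lra. }
  destruct (functional_choice _ Hx) as [u Hu].
  assert (HCu : cauchy X u).
  { intros eps He. destruct (small_inv (eps * eps / 8)) as [N HN]; [nra|].
    exists N. intros n m Hn Hm. pose proof (HN n Hn). pose proof (HN m Hm).
    destruct (Hu n) as [Mn En], (Hu m) as [Mm Em].
    (* As the midpoint of [u n] and [u m] lies in [M], the parallelogram law bounds their squared
       distance by 2/(n+1) + 2/(m+1), which is below eps^2/2. *)
    unfold vdist. apply Rle_lt_trans with (eps * / sqrt 2).
    - pose proof (Hd ((/ 2) *v (u n +v u m)) ltac:(apply S, S; assumption)) as P.
      assert (0 < sqrt 2) by (apply sqrt_lt_R0; lra).
      apply vnorm_le; [apply Rmult_le_pos; [lra|left; apply Rinv_0_lt_compat; lra]|].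
      replace (eps * / sqrt 2 * (eps * / sqrt 2)) with (eps * eps / (sqrt 2 * sqrt 2)) by (field; lra).
      rewrite sqrt_sqrt by lra.
      autorewrite with ri in *. rewrite ?(ri_sym X (u n) x), ?(ri_sym X (u m) x), ?(ri_sym X (u m) (u n)) in *. lra.
    - rewrite <- (Rmult_1_r eps) at 2. apply Rmult_lt_compat_l; [lra|].
      rewrite <- Rinv_1 at 1. apply Rinv_lt_contravar; [|]; rewrite ?Rmult_1_l; pose proof sqrt_lt_1 1 2; rewrite ?sqrt_1 in *; lra. }
  destruct (HC u HCu) as [p Hp]. exists p. split; [apply (HM u p); [intro; apply Hu|exact Hp]|].
  intros m Hm.
  (* Minimality of [d] along the perturbation [u n + t m]. *)
  assert (Key : forall t, 2 * t * ri (x -v p) m <= t * t * ri m m).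
  { intro t.
    assert (L : Un_cv (fun n => 2 * t * (ri x m - ri (u n) m) - / INR (Datatypes.S n)) (2 * t * (ri x m - ri p m) - 0)).
    { apply CV_minus; [apply CV_mult; [apply (CV_const (2 * t))|apply CV_minus; [apply (CV_const (ri x m))|apply cv_ri, Hp]]|].
      intros eps He. destruct (small_inv eps He) as [N HN]. exists N. intros n Hn. unfold Rdist.
      rewrite Rminus_0_r, Rabs_pos_eq; [apply HN, Hn|left; apply Rinv_0_lt_compat, lt_0_INR; lia]. }
    replace (2 * t * ri (x -v p) m) with (2 * t * (ri x m - ri p m) - 0) by (autorewrite with ri; ring).
    eapply Rle_cv_lim; [|apply L|apply (CV_const (t * t * ri m m))].
    intro n. destruct (Hu n) as [Mn En]. cbv beta.
    pose proof (Hd (u n +v t *v m) ltac:(apply S; [assumption|apply S; assumption])) as P.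
    autorewrite with ri in P, En. rewrite ?(ri_sym X (u n) x), ?(ri_sym X m x), ?(ri_sym X m (u n)) in *. lra. }
  set (r := ri (x -v p) m) in *. pose proof (ri_pos X m).
  (* Close to the optimal t = r / |m|^2; the added 1 avoids a zero denominator and still bounds a
     positive multiple of [r * r] by 0. *)
  specialize (Key (r / (ri m m + 1))).
  assert (E : 2 * (r / (ri m m + 1)) * r - r / (ri m m + 1) * (r / (ri m m + 1)) * ri m m = 
     r * r * ((ri m m + 2) / ((ri m m + 1) * (ri m m + 1)))) by (field; lra).
  assert (0 < (ri m m + 2) / ((ri m m + 1) * (ri m m + 1))) by (apply Rdiv_lt_0_compat; nra).
  assert (r * r <= 0) by nra. nra.
Qed.

Lemma orth_orth M x : complete X -> subsp M -> closed M -> orth (orth M) x -> M x.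
Proof.
  intros HC S HM E. destruct (projection M x HC S HM) as [p [Mp Op]].
  replace x with p; [assumption|]. symmetry. apply sub_zero, ri_def.
  rewrite ri_add_l, ri_opp_l, (E _ Op), ri_sym, (Op _ Mp). ring.
Qed.

(** The closure [M] of [W] is a closed subspace. The residual of projecting [x] on it is orthogonal
    to [W], hence zero. *)
Lemma dense_orth (W : X -> Prop) : complete X -> subsp W ->
  (forall x, orth W x -> x = vzero) -> dense X W.
Proof.
  intros HC S Z.
  set (M := fun x : X => forall eps, 0 < eps -> exists y, W y /\ vdist x y < eps).
  assert (SM : subsp M).
  { split; [|split].
    - intros eps He. exists vzero. split; [apply S|]. unfold vdist. rewrite vadd_opp, vnorm_zero. exact He.
    - intros x y Hx Hy eps He. destruct (Hx (eps / 2)) as [a [Wa Da]]; [lra|]. destruct (Hy (eps / 2)) as [b [Wb Db]]; [lra|].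
      exists (a +v b). split; [apply S; assumption|]. unfold vdist in *.
      replace (x +v y -v (a +v b)) with ((x -v a) +v (y -v b)) by vec.
      eapply Rle_lt_trans; [apply vnorm_add|]. lra.
    - intros c x Hx eps He. pose proof (Rabs_pos (Re c)). pose proof (Rabs_pos (Im c)).
      set (k := Rabs (Re c) + Rabs (Im c) + 1).
      destruct (Hx (eps / k)) as [a [Wa Da]]; [apply Rdiv_lt_0_compat; unfold k; lra|].
      exists (vscal c a). split; [apply S, Wa|]. unfold vdist in *.
      replace (vscal c x -v vscal c a) with (Re c *v (x -v a) +v Im c *v J (x -v a))
        by (apply vext; intro; autorewrite with ri; rewrite !vscal_ri, !ri_J; autorewrite with ri; ring).
      eapply Rle_lt_trans; [apply vnorm_add|]. rewrite !vnorm_scal, vnorm_J.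
      pose proof (vnorm_pos X (x -v a)).
      apply Rle_lt_trans with (k * vnorm (x -v a)); [unfold k; nra|].
      replace eps with (k * (eps / k)) by (field; unfold k; lra). apply Rmult_lt_compat_l; unfold k in *; lra. }
  assert (HM : closed M).
  { intros u l Hu C eps He. destruct (C (eps / 2)) as [N HN]; [lra|]. destruct (Hu N (eps / 2)) as [y [Wy Dy]]; [lra|].
    exists y. split; [assumption|]. specialize (HN N ltac:(lia)). unfold vdist in *. rewrite vnorm_sym in HN.
    eapply Rle_lt_trans; [apply (vnorm_tri _ _ (u N))|]. lra. }
  intro x. destruct (projection M x HC SM HM) as [p [Mp Op]].
  replace x with p; [exact Mp|]. symmetry. apply sub_zero, Z. intros w Hw. apply Op.
  intros eps He. exists w. split; [assumption|]. unfold vdist. rewrite vadd_opp, vnorm_zero. exact He.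
Qed.

Lemma dense_ext (W : X -> Prop) x y : dense X W -> (forall w, W w -> ri x w = ri y w) -> x = y.
Proof.
  intros D E. apply vext. intro z. destruct (dense_seq X W z D) as [u [Hu C]].
  rewrite !(ri_sym X _ z). eapply UL_sequence; [apply cv_ri, C|].
  assert (F : forall n, ri (u n) x = ri (u n) y) by (intro; rewrite !(ri_sym X (u _)); apply E, Hu).
  intros eps He. destruct (cv_ri X u z y C eps He) as [N HN]. exists N. intros n Hn. rewrite F. apply HN, Hn.
Qed.

End Projection.

(** * Self-adjoint operators and square roots *)

Definition lin {X Y : PreHilbert} (f : X -> Y) : Prop :=
  (forall x y, f (x +v y) = f x +v f y) /\ (forall c x, f (vscal c x) = vscal c (f x)).
Definition symm {X : PreHilbert} (f : X -> X) : Prop := forall x y, ri (f x) y = ri x (f y).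

Lemma lin_sub (X Y : PreHilbert) (f : X -> Y) x y : lin f -> f (x -v y) = f x -v f y.
Proof.
  intros [A B]. replace (vopp y) with ((-1) *v y) by vec. rewrite A, B. vec.
Qed.

Lemma lin_zero (X Y : PreHilbert) (f : X -> Y) : lin f -> f vzero = vzero.
Proof.
  intro L. replace (vzero : X) with ((vzero : X) -v vzero) by vec.
  rewrite lin_sub by assumption. apply vadd_opp.
Qed.

Section SelfAdjoint.
Variable H : PreHilbert.
Variable T : op H.

Lemma dom_subsp : linear_op T -> subsp (dom T).
Proof.
  intros [Z [A B]]. split; [exact Z|split].
  - intros x y Hx Hy. apply A; assumption.
  - intros c x Hx. apply B; assumption.
Qed.

Lemma ap_add x y : linear_op T -> dom T x -> dom T y -> ap T (x +v y) = ap T x +v ap T y.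
Proof. intros L Hx Hy. apply L; assumption. Qed.

Lemma ap_scal c x : linear_op T -> dom T x -> ap T (vscal c x) = vscal c (ap T x).
Proof. intros L Hx. apply L; assumption. Qed.

Lemma ap_sub x y : linear_op T -> dom T x -> dom T y -> ap T (x -v y) = ap T x -v ap T y.
Proof.
  intros L Hx Hy. replace (vopp y) with ((-1) *v y) by vec.
  rewrite ap_add, ap_scal; try assumption; [vec|apply dom_subsp; assumption].
Qed.

Lemma sa_lin : self_adjoint T -> linear_op T.
Proof. intros S. apply S. Qed.

Lemma sa_symm x y : self_adjoint T -> dom T x -> dom T y -> ri (ap T x) y = ri x (ap T y).
Proof.
  intros [L [D A]] Hx Hy. unfold ri. f_equal. apply (A y (ap T y)); [split; [assumption|reflexivity]|assumption].
Qed.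

(** Applying the real identity to [J w] yields the imaginary part, so adjoint conditions can be
    checked with [ri] alone. *)
Lemma inner_ri_eq x y : linear_op T ->
  (forall w, dom T w -> ri (ap T w) x = ri w y) -> forall w, dom T w -> inner (ap T w) x = inner w y.
Proof.
  intros L E w Hw. apply C_ext; [apply E, Hw|].
  assert (F : ri (J (ap T w)) x = ri (J w) y).
  { unfold J. rewrite <- ap_scal by assumption. apply E. apply dom_subsp; assumption. }
  rewrite !ri_J_l in F. lra.
Qed.

Lemma sa_dom y z : self_adjoint T ->
  (forall x, dom T x -> ri (ap T x) y = ri x z) -> dom T y /\ z = ap T y.
Proof.
  intros S E. apply S. apply inner_ri_eq; [apply S|exact E].
Qed.

Lemma sa_intro : linear_op T -> dense H (dom T) ->
  (forall x y, dom T x -> dom T y -> ri (ap T x) y = ri x (ap T y)) ->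
  (forall y z, (forall x, dom T x -> ri (ap T x) y = ri x z) -> dom T y /\ z = ap T y) ->
  self_adjoint T.
Proof.
  intros L D S A. split; [assumption|split; [assumption|]]. intros y z. split.
  - intro E. apply A. intros x Hx. unfold ri. rewrite E by assumption. reflexivity.
  - intros [Hy ->]. apply inner_ri_eq; [assumption|]. intros w Hw. apply S; assumption.
Qed.

Lemma sa_closed u x y : self_adjoint T -> (forall n, dom T (u n)) ->
  converges_to H u x -> converges_to H (fun n => ap T (u n)) y -> dom T x /\ y = ap T x.
Proof.
  intros S Hu Cx Cy. apply sa_dom; [assumption|]. intros w Hw.
  pose proof (cv_ri H u x (ap T w) Cx) as A. pose proof (cv_ri H _ y w Cy) as B.
  rewrite ri_sym, (ri_sym H w y). eapply UL_sequence; [apply A|].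
  intros eps He. destruct (B eps He) as [N HN]. exists N. intros n Hn.
  rewrite <- sa_symm by auto. apply HN, Hn.
Qed.

(** A sequence of the domain converging to [x] has Cauchy images, and the graph is closed. This
    serves to show that the restricted operators are unbounded. *)
Lemma bounded_sa_total : complete H -> self_adjoint T -> Defs.bounded T -> forall x, dom T x.
Proof.
  intros HC S [M HM] x. destruct (dense_seq H (dom T) x) as [u [Hu C]]; [apply S|].
  assert (CT : cauchy H (fun n => ap T (u n))).
  { apply (cauchy_lip H H u _ (Rabs M)); [apply Rabs_pos| |apply (cv_cauchy H u x C)].
    intros n m. rewrite <- ap_sub; [|apply S|apply Hu|apply Hu].
    eapply Rle_trans; [apply HM, subsp_sub; [apply dom_subsp, S|apply Hu|apply Hu]|].
    apply Rmult_le_compat_r; [apply vnorm_pos|apply Rle_abs]. }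
  destruct (HC _ CT) as [y Hy]. apply (sa_closed u x y); assumption.
Qed.

Lemma one_plus_lower x : Defs.nonneg T -> dom T x ->
  vnorm x <= vnorm (x +v ap T x) /\ vnorm (ap T x) <= vnorm (x +v ap T x).
Proof.
  intros P Hx. specialize (P x Hx). fold (ri (ap T x) x) in P.
  assert (E : ri (x +v ap T x) (x +v ap T x) = ri x x + 2 * ri (ap T x) x + ri (ap T x) (ap T x))
    by (autorewrite with ri; rewrite (ri_sym H x (ap T x)); ring).
  rewrite <- vnorm_sq in E. pose proof (ri_pos H x). pose proof (ri_pos H (ap T x)).
  split; apply vnorm_le; try apply vnorm_pos; lra.
Qed.

(** [A] is (1+T)^{-1}. The range of 1+T is dense, and [one_plus_lower] makes preimages of a
    convergent sequence Cauchy together with their images under [T], so the range is all of [H]. *)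
Lemma resolvent : complete H -> nonneg_self_adjoint T ->
  exists A : H -> H, forall h, dom T (A h) /\ ap T (A h) = h -v A h.
Proof.
  intros HC [S P]. apply (functional_choice (fun h y => dom T y /\ ap T y = h -v y)). intro h.
  pose proof (dom_subsp (sa_lin S)) as SD.
  assert (D : dense H (fun y => exists x, dom T x /\ y = x +v ap T x)).
  { apply dense_orth; [assumption| |].
    - split; [|split].
      + exists vzero. split; [apply SD|]. replace (ap T vzero) with (vscal (mkC 0 0) (ap T vzero)).
        * vec.
        * rewrite <- ap_scal; [f_equal; vec|apply S|apply SD].
      + intros y y' [x [Hx ->]] [x' [Hx' ->]]. exists (x +v x'). split; [apply SD; assumption|].
        rewrite ap_add; [vec|apply S|assumption|assumption].
      + intros c y [x [Hx ->]]. exists (vscal c x). split; [apply SD; assumption|].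
        rewrite ap_scal, vscal_distr_v; [reflexivity|apply S|assumption].
    - intros z Oz.
      (* A vector orthogonal to the range satisfies T z = -z, which non-negativity allows only for z
         = 0. *)
      destruct (sa_dom z (vopp z) S) as [Dz Ez].
      { intros x Hx. specialize (Oz _ (ex_intro _ x (conj Hx eq_refl))).
        autorewrite with ri in *. rewrite (ri_sym H z x), (ri_sym H z (ap T x)) in Oz. lra. }
      apply ri_def. specialize (P z Dz). fold (ri (ap T z) z) in P. rewrite <- Ez, ri_opp_l in P.
      pose proof (ri_pos H z). lra. }
  destruct (dense_seq H _ h D) as [u [Hu C]]. destruct (functional_choice _ Hu) as [x Hx].
  assert (Lip : forall n m, vnorm (x n -v x m) <= 1 * vnorm (u n -v u m) /\
                            vnorm (ap T (x n) -v ap T (x m)) <= 1 * vnorm (u n -v u m)).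
  { intros n m. destruct (Hx n) as [Dn En], (Hx m) as [Dm Em].
    assert (Dd : dom T (x n -v x m)) by (apply subsp_sub; assumption).
    rewrite <- ap_sub; [|apply S|assumption|assumption].
    replace (u n -v u m) with ((x n -v x m) +v ap T (x n -v x m)).
    - rewrite Rmult_1_l. apply one_plus_lower; assumption.
    - rewrite ap_sub, En, Em; [vec|apply S|assumption|assumption]. }
  pose proof (cv_cauchy H u h C) as Cu.
  destruct (HC x) as [l Cl].
  { apply (cauchy_lip H H u x 1); [lra|apply Lip|assumption]. }
  destruct (HC (fun n => ap T (x n))) as [l' Cl'].
  { apply (cauchy_lip H H u _ 1); [lra|apply Lip|assumption]. }
  destruct (sa_closed x l l' S (fun n => proj1 (Hx n)) Cl Cl') as [Dl El].
  exists l. split; [assumption|]. rewrite <- El.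
  assert (E : h = l +v l').
  { apply (cv_eq H u); [assumption|]. pose proof (cv_add H _ _ _ _ Cl Cl') as Q.
    intros eps He. destruct (Q eps He) as [N HN]. exists N. intros n Hn.
    rewrite (proj2 (Hx n)). apply HN, Hn. }
  rewrite E. vec.
Qed.

End SelfAdjoint.

(** * Square roots of bounded operators by iteration *)

Section SquareRoot.
Variable X : PreHilbert.
Implicit Types f g : X -> X.

Lemma vscal_real_comm (a : R) (c : Defs.C) (x : X) : a *v vscal c x = vscal c (a *v x).
Proof. rewrite !vscal_assoc. f_equal. apply C_ext; simpl; ring. Qed.

(* The iteration Y := (f + Y^2) / 2 converges to 1 - (1 - f)^{1/2}; for a contraction [f] its
   increments are dominated in norm by those of [sqrt_bound], the same iteration for f = 1. *)
Fixpoint sqrt_iter f n (x : X) : X :=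
  match n with
  | O => vzero
  | S n => (/ 2) *v (f x +v sqrt_iter f n (sqrt_iter f n x))
  end.

Fixpoint sqrt_bound (n : nat) : R :=
  match n with
  | O => 0
  | S n => / 2 * (1 + sqrt_bound n * sqrt_bound n)
  end.

Lemma sqrt_bound_range n : 0 <= sqrt_bound n <= 1.
Proof. induction n; simpl; [lra|nra]. Qed.

Lemma sqrt_bound_growing n : sqrt_bound n <= sqrt_bound (S n).
Proof. simpl. pose proof (sqrt_bound_range n). nra. Qed.

Lemma sqrt_iter_lin f n : lin f -> lin (sqrt_iter f n).
Proof.
  intros [A B]. induction n as [|n [IA IB]]; simpl; split.
  - intros. vec.
  - intros. apply vext. intro. rewrite vscal_ri, ri_J, !ri_zero_l. ring.
  - intros. rewrite A, !IA. vec.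
  - intros. rewrite B, !IB, <- vscal_distr_v. apply vscal_real_comm.
Qed.

Lemma sqrt_iter_symm f n : symm f -> symm (sqrt_iter f n).
Proof.
  intros A. induction n as [|n IH]; intros x y; simpl; autorewrite with ri; [reflexivity|].
  rewrite A, !IH. reflexivity.
Qed.

Lemma sqrt_iter_comm f g n : lin g -> (forall x, g (f x) = f (g x)) ->
  forall x, g (sqrt_iter f n x) = sqrt_iter f n (g x).
Proof.
  intros [A B] E. induction n as [|n IH]; intro x; simpl.
  - apply lin_zero. split; assumption.
  - rewrite B, A, E, !IH. reflexivity.
Qed.

Lemma sqrt_iter_norm f n : (forall x, vnorm (f x) <= vnorm x) ->
  forall x, vnorm (sqrt_iter f n x) <= sqrt_bound n * vnorm x.
Proof.
  intros C. induction n as [|n IH]; intro x; simpl; [rewrite vnorm_zero; lra|].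
  rewrite vnorm_scal, Rabs_pos_eq by lra.
  pose proof (vnorm_add X (f x) (sqrt_iter f n (sqrt_iter f n x))).
  pose proof (C x). pose proof (IH x). pose proof (IH (sqrt_iter f n x)).
  pose proof (sqrt_bound_range n). pose proof (vnorm_pos X x). nra.
Qed.

(** Since the iterates commute, Y_{n+2} - Y_{n+1} = (Y_{n+1} + Y_n)(Y_{n+1} - Y_n) / 2. The scalars
    [sqrt_bound] obey the same recursion, so the estimate propagates. *)
Lemma sqrt_iter_step f n : lin f -> (forall x, vnorm (f x) <= vnorm x) -> forall x,
  vnorm (sqrt_iter f (S n) x -v sqrt_iter f n x) <= (sqrt_bound (S n) - sqrt_bound n) * vnorm x.
Proof.
  intros L C. induction n as [|n IH]; intro x.
  - simpl. replace ((/ 2) *v (f x +v vzero) -v vzero) with ((/ 2) *v f x) by vec.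
    rewrite vnorm_scal, Rabs_pos_eq by lra. specialize (C x). lra.
  - pose proof (sqrt_iter_lin f n L) as [An _].
    set (d := sqrt_iter f (S n) x -v sqrt_iter f n x).
    replace (sqrt_iter f (S (S n)) x -v sqrt_iter f (S n) x)
      with ((/ 2) *v (sqrt_iter f (S n) d +v sqrt_iter f n d)).
    + rewrite vnorm_scal, Rabs_pos_eq by lra.
      eapply Rle_trans; [apply Rmult_le_compat_l; [lra|apply vnorm_add]|].
      pose proof (sqrt_iter_norm f (S n) C d). pose proof (sqrt_iter_norm f n C d).
      pose proof (sqrt_bound_range n). pose proof (sqrt_bound_range (S n)). pose proof (IH x).
      fold d in H3. pose proof (vnorm_pos X x).
      change (sqrt_bound (S (S n))) with (/ 2 * (1 + sqrt_bound (S n) * sqrt_bound (S n))).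
      apply Rle_trans with (/ 2 * ((sqrt_bound (S n) + sqrt_bound n) * ((sqrt_bound (S n) - sqrt_bound n) * vnorm x))).
      * nra.
      * right. assert (sqrt_bound (S n) = / 2 * (1 + sqrt_bound n * sqrt_bound n)) by reflexivity.
        set (s := sqrt_bound (S n)) in *. rewrite H5 at 5. ring.
    + unfold d. rewrite !lin_sub by (apply sqrt_iter_lin, L).
      rewrite (sqrt_iter_comm f (sqrt_iter f (S n)) n (sqrt_iter_lin f _ L)
        (fun y => eq_sym (sqrt_iter_comm f f (S n) L (fun z => eq_refl) y))).
      change (sqrt_iter f (S (S n)) x) with ((/ 2) *v (f x +v sqrt_iter f (S n) (sqrt_iter f (S n) x))).
      assert (E : sqrt_iter f (S n) x = (/ 2) *v (f x +v sqrt_iter f n (sqrt_iter f n x))) by reflexivity.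
      set (s := sqrt_iter f (S n) x) in *. apply vext. intro z.
      apply (f_equal (fun w => ri w z)) in E. autorewrite with ri in *. lra.
Qed.

Lemma sqrt_iter_diff f n k : lin f -> (forall x, vnorm (f x) <= vnorm x) -> forall x,
  vnorm (sqrt_iter f (k + n) x -v sqrt_iter f n x) <= (sqrt_bound (k + n) - sqrt_bound n) * vnorm x.
Proof.
  intros L C x. induction k as [|k IH].
  - simpl. rewrite vadd_opp, vnorm_zero. lra.
  - change (S k + n)%nat with (S (k + n)).
    eapply Rle_trans; [apply (vnorm_tri X _ (sqrt_iter f (k + n) x))|].
    pose proof (sqrt_iter_step f (k + n) L C x). lra.
Qed.

(** [sqrt_bound] is increasing and at most 1, hence Cauchy, and its differences dominate those of
    the iterates. *)
Lemma sqrt_iter_cauchy f : lin f -> (forall x, vnorm (f x) <= vnorm x) -> forall x,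
  cauchy X (fun n => sqrt_iter f n x).
Proof.
  intros L C x eps He.
  assert (Cb : Cauchy_crit sqrt_bound).
  { apply CV_Cauchy. apply growing_cv; [exact sqrt_bound_growing|].
    exists 1. intros r [n ->]. apply sqrt_bound_range. }
  pose proof (vnorm_pos X x).
  destruct (Cb (eps / (vnorm x + 1))) as [N HN]; [apply Rdiv_lt_0_compat; lra|].
  assert (K : forall n m, (N <= n)%nat -> (N <= m)%nat -> (n <= m)%nat ->
    vnorm (sqrt_iter f m x -v sqrt_iter f n x) < eps).
  { intros n m Hn Hm L'. replace m with ((m - n) + n)%nat by lia.
    eapply Rle_lt_trans; [apply sqrt_iter_diff; assumption|]. replace ((m - n) + n)%nat with m by lia.
    specialize (HN m n Hm Hn). unfold Rdist in HN. pose proof (Rle_abs (sqrt_bound m - sqrt_bound n)).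
    apply Rle_lt_trans with (Rabs (sqrt_bound m - sqrt_bound n) * (vnorm x + 1)).
    - pose proof (Rabs_pos (sqrt_bound m - sqrt_bound n)). nra.
    - apply (Rmult_lt_compat_r (vnorm x + 1)) in HN; [|lra].
      replace (eps / (vnorm x + 1) * (vnorm x + 1)) with eps in HN by (field; lra). exact HN. }
  exists N. intros n m Hn Hm. unfold vdist. destruct (Nat.le_ge_cases n m).
  - rewrite vnorm_sym. apply K; assumption.
  - apply K; assumption.
Qed.

(** With Y the limit of the iteration, b = 1 - Y is (1 - f)^{1/2}. The bound on 1 - b allows a
    second application with 1 - b in place of [f], giving a fourth root. *)
Lemma square_root f : complete X -> lin f -> symm f -> (forall x, vnorm (f x) <= vnorm x) ->
  exists b : X -> X, lin b /\ symm b /\ (forall x, 0 <= ri (b x) x) /\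
    (forall x, b (b x) = x -v f x) /\ (forall x, vnorm (x -v b x) <= vnorm x) /\
    (forall g c, lin g -> (forall x, vnorm (g x) <= c * vnorm x) ->
       (forall x, g (f x) = f (g x)) -> forall x, g (b x) = b (g x)).
Proof.
  intros HC L Sy C.
  destruct (functional_choice (fun x l => converges_to X (fun n => sqrt_iter f n x) l)) as [Y HY].
  { intro x. apply HC, sqrt_iter_cauchy; assumption. }
  assert (LY : lin Y).
  { split.
    - intros x y. apply (cv_eq X (fun n => sqrt_iter f n (x +v y))); [apply HY|].
      intros eps He. destruct (cv_add X _ _ _ _ (HY x) (HY y) eps He) as [N HN]. exists N. intros n Hn.
      rewrite (proj1 (sqrt_iter_lin f n L)). apply HN, Hn.
    - intros c x. apply vext. intro z. rewrite vscal_ri.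
      eapply UL_sequence; [apply cv_ri, HY|].
      intros eps He.
      destruct (CV_plus _ _ _ _ (CV_mult _ _ _ _ (CV_const (Re c)) (cv_ri X _ _ z (HY x)))
        (CV_mult _ _ _ _ (CV_const (- Im c)) (cv_ri X _ _ (J z) (HY x))) eps He) as [N HN].
      exists N. intros n Hn. specialize (HN n Hn).
      rewrite (proj2 (sqrt_iter_lin f n L)), vscal_ri, !ri_J.
      replace (Re c * ri (Y x) z + Im c * - ri (Y x) (J z)) with (Re c * ri (Y x) z + - Im c * ri (Y x) (J z)) by ring.
      replace (Im c * - ri (sqrt_iter f n x) (J z)) with (- Im c * ri (sqrt_iter f n x) (J z)) by ring.
      exact HN. }
  assert (SY : symm Y).
  { intros x y. eapply UL_sequence; [apply cv_ri, HY|]. rewrite ri_sym.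
    intros eps He. destruct (cv_ri X _ _ x (HY y) eps He) as [N HN]. exists N. intros n Hn.
    rewrite (sqrt_iter_symm f n Sy), ri_sym. apply HN, Hn. }
  assert (NY : forall x, vnorm (Y x) <= vnorm x).
  { intro x. apply (cv_norm_le X _ _ _ (HY x)). exists 0%nat. intros n _.
    eapply Rle_trans; [apply sqrt_iter_norm, C|]. pose proof (sqrt_bound_range n). pose proof (vnorm_pos X x). nra. }
  assert (EY : forall x, Y x = (/ 2) *v (f x +v Y (Y x))).
  { intro x.
    (* The difference splits as Y_n (Y_n x - Y x) + (Y_n - Y)(Y x); the first term is small because
       every Y_n is a contraction. *)
    assert (Q : converges_to X (fun n => sqrt_iter f n (sqrt_iter f n x)) (Y (Y x))).
    { intros eps He. destruct (HY x (eps / 2)) as [N HN]; [lra|]. destruct (HY (Y x) (eps / 2)) as [M HM]; [lra|].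
      exists (N + M)%nat. intros n Hn. specialize (HN n ltac:(lia)). specialize (HM n ltac:(lia)). unfold vdist in *.
      eapply Rle_lt_trans; [apply (vnorm_tri X _ (sqrt_iter f n (Y x)))|].
      rewrite <- lin_sub by (apply sqrt_iter_lin, L).
      pose proof (sqrt_iter_norm f n C (sqrt_iter f n x -v Y x)). pose proof (sqrt_bound_range n).
      pose proof (vnorm_pos X (sqrt_iter f n x -v Y x)). nra. }
    apply (cv_eq X (fun n => sqrt_iter f (S n) x)).
    - intros eps He. destruct (HY x eps He) as [N HN]. exists N. intros n Hn. apply HN. lia.
    - simpl. intros eps He. destruct (Q eps He) as [N HN]. exists N. intros n Hn. specialize (HN n Hn). unfold vdist in *.
      replace ((/ 2) *v (f x +v sqrt_iter f n (sqrt_iter f n x)) -v (/ 2) *v (f x +v Y (Y x)))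
        with ((/ 2) *v (sqrt_iter f n (sqrt_iter f n x) -v Y (Y x))) by vec.
      rewrite vnorm_scal, Rabs_pos_eq by lra.
      pose proof (vnorm_pos X (sqrt_iter f n (sqrt_iter f n x) -v Y (Y x))). lra. }
  assert (CY : forall g c, lin g -> (forall x, vnorm (g x) <= c * vnorm x) ->
       (forall x, g (f x) = f (g x)) -> forall x, g (Y x) = Y (g x)).
  { intros g c Lg Bg Eg x. apply (cv_eq X (fun n => g (sqrt_iter f n x))).
    - apply (cv_lip X X _ _ g c); [|apply HY]. intros y z. rewrite <- lin_sub by assumption. apply Bg.
    - intros eps He. destruct (HY (g x) eps He) as [N HN]. exists N. intros n Hn.
      rewrite sqrt_iter_comm by assumption. apply HN, Hn. }
  exists (fun x => x -v Y x). split; [|split; [|split; [|split; [|split]]]].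
  - destruct LY as [A B]. split; intros.
    + rewrite A. vec.
    + rewrite B. apply vext. intro. autorewrite with ri. rewrite !vscal_ri, !ri_J. autorewrite with ri. ring.
  - intros x y. autorewrite with ri. rewrite SY. reflexivity.
  - intro x. autorewrite with ri. pose proof (cauchy_schwarz X (Y x) x). rewrite <- vnorm_sq.
    pose proof (NY x). pose proof (vnorm_pos X x). nra.
  - intro x. rewrite lin_sub by assumption. apply vext. intro z. autorewrite with ri.
    rewrite (EY x) at 1 2. autorewrite with ri. lra.
  - intro x. replace (x -v (x -v Y x)) with (Y x) by vec. apply NY.
  - intros g c Lg Bg Eg x. rewrite lin_sub by assumption. rewrite (CY g c) by assumption. reflexivity.
Qed.

End SquareRoot.

(** * Subspaces meeting a dense domain trivially *)

(** Vanishing against both [e] and [J e] is complex orthogonality expressed through [ri]. *)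
Definition perp {X : PreHilbert} (z : X) (L : list X) : Prop :=
  forall e, In e L -> ri z e = 0 /\ ri z (J e) = 0.

Section Basis.
(** In the application [X] is the form domain, [D] is dom T and [N] is the norm of H. [D_cont] then
    rests on (x, d)_X = (x, d + T d)_H, and [D_unbounded] on the unboundedness of T. *)
Variable X : PreHilbert.
Variable D : X -> Prop.
Variable N : X -> R.
Hypothesis HC : complete X.
Hypothesis D_subsp : subsp D.
Hypothesis N_pos : forall x, 0 <= N x.
Hypothesis N_sub : forall x y, N (x -v y) <= N x + N y.
Hypothesis N_scal : forall a x, N (a *v x) = Rabs a * N x.
Hypothesis N_le : forall x, N x <= vnorm x.
Hypothesis D_cont : forall d, D d -> exists c, 0 <= c /\ forall x, Rabs (ri x d) <= c * N x.
Hypothesis D_unbounded : forall c, exists x, D x /\ c * N x < vnorm x.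

(* The orthogonal projection onto the span of [L] exists, preserves [D], and is bounded from
   the weak norm [N] to the norm of [X]. *)
Definition good (L : list X) : Prop :=
  exists c, 0 <= c /\ forall x, D x -> exists p, D p /\ vnorm p <= c * N x /\
    perp (x -v p) L /\ (forall z, perp z L -> ri z p = 0).

Lemma good_nil : good nil.
Proof.
  exists 0. split; [lra|]. intros x Hx. exists vzero. rewrite vnorm_zero.
  split; [apply D_subsp|split; [lra|split]].
  - intros e [].
  - intros. apply ri_zero_r.
Qed.

(** The new projection adds the components along [e] and [J e]; both vectors lie in [D], so [D_cont]
    bounds these coefficients by [N]. *)
Lemma good_cons L e : good L -> D e -> vnorm e = 1 -> perp e L -> good (e :: L).
Proof.
  intros [c [Hc G]] De Ne Pe.
  assert (DJ : D (J e)) by (apply D_subsp, De).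
  destruct (D_cont e De) as [c1 [Hc1 B1]]. destruct (D_cont (J e) DJ) as [c2 [Hc2 B2]].
  assert (E1 : ri e e = 1) by (rewrite <- vnorm_sq, Ne; ring).
  exists (c + c1 + c2). split; [lra|]. intros x Dx.
  destruct (G x Dx) as [p [Dp [Np [Pp Zp]]]].
  assert (PJ : perp (J e) L).
  { intros l Hl. destruct (Pe l Hl). rewrite ri_J, ri_J_J. split; lra. }
  exists (p +v (ri x e *v e +v ri x (J e) *v J e)).
  split; [|split; [|split]].
  - apply D_subsp; [assumption|]. apply D_subsp; apply D_subsp; assumption.
  - pose proof (vnorm_add X p (ri x e *v e +v ri x (J e) *v J e)).
    pose proof (vnorm_add X (ri x e *v e) (ri x (J e) *v J e)).
    rewrite !vnorm_scal, vnorm_J, Ne in H0.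
    specialize (B1 x). specialize (B2 x). lra.
  - intros l [<-|Hl].
    + pose proof (Zp e Pe) as Q1. pose proof (Zp (J e) PJ) as Q2.
      autorewrite with ri. rewrite ri_J_J, E1, (ri_sym X (J e) e), ri_J_self.
      rewrite (ri_sym X p e), (ri_sym X p (J e)), Q1, Q2. split; ring.
    + destruct (Pp l Hl) as [A B]. destruct (Pe l Hl) as [A' B']. destruct (PJ l Hl) as [A'' B''].
      autorewrite with ri in *. rewrite A', B', A'', B''. split; lra.
  - intros z Pz. autorewrite with ri. rewrite (Zp z) by (intros l Hl; apply Pz; right; assumption).
    destruct (Pz e) as [A B]; [left; reflexivity|]. rewrite A, B. ring.
Qed.

Lemma normalize (x : X) : x <> vzero -> 0 < vnorm x /\ vnorm (/ vnorm x *v x) = 1.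
Proof.
  intro Hx. pose proof (vnorm_pos X x).
  destruct (Req_dec (vnorm x) 0) as [Z|Z].
  - exfalso. apply Hx, ri_def. rewrite <- vnorm_sq, Z. ring.
  - split; [lra|]. rewrite vnorm_scal, Rabs_pos_eq by (left; apply Rinv_0_lt_compat; lra). field. assumption.
Qed.

Lemma perp_scal a (x : X) L : perp x L -> perp (a *v x) L.
Proof. intros P e He. destruct (P e He) as [A B]. rewrite !ri_scal_l, A, B. split; ring. Qed.

Lemma small_unit L eps : good L -> 0 < eps -> exists e, D e /\ vnorm e = 1 /\ perp e L /\ N e <= eps.
Proof.
  intros [c [Hc G]] He.
  (* Subtracting [p] lowers the norm by at most [c * N x] and multiplies [N] by at most 1 + c; the
     ratio is chosen so that [N q] is still below [eps * vnorm q]. *)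
  destruct (D_unbounded (c + (1 + c) / eps)) as [x [Dx Ux]].
  destruct (G x Dx) as [p [Dp [Np [Pp _]]]].
  set (q := x -v p) in *.
  assert (Nq : N q <= (1 + c) * N x).
  { pose proof (N_sub x p). pose proof (N_le p). fold q in H. lra. }
  assert (Vq : (1 + c) / eps * N x < vnorm q).
  { pose proof (vnorm_add X q p). replace (q +v p) with x in H by (unfold q; vec). lra. }
  pose proof (N_pos x).
  assert (K : (1 + c) * N x < eps * vnorm q).
  { apply (Rmult_lt_compat_l eps) in Vq; [|assumption].
    replace (eps * ((1 + c) / eps * N x)) with ((1 + c) * N x) in Vq by (field; lra). exact Vq. }
  assert (Hq : q <> vzero).
  { intro Z. rewrite Z, vnorm_zero in K. nra. }
  destruct (normalize q Hq) as [P1 P2].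
  exists (/ vnorm q *v q). split; [|split; [assumption|split]].
  - apply D_subsp, subsp_sub; assumption.
  - apply perp_scal, Pp.
  - rewrite N_scal, Rabs_pos_eq by (left; apply Rinv_0_lt_compat, P1).
    apply (Rmult_le_reg_l (vnorm q)); [assumption|].
    rewrite <- Rmult_assoc, Rinv_r, Rmult_1_l by lra. lra.
Qed.

(** [e] is the normalised residual of [d] over the span of [L]. If the residual vanishes, [d] is
    already in that span and any unit vector of [D] orthogonal to [L] will do. *)
Lemma capture_unit L d : good L -> D d ->
  exists e, D e /\ vnorm e = 1 /\ perp e L /\ (forall z, perp z (e :: L) -> ri z d = 0).
Proof.
  intros GL Dd. destruct GL as [c [Hc G]] eqn:EG. clear EG.
  destruct (G d Dd) as [p [Dp [Np [Pp Zp]]]].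
  destruct (classic (d -v p = vzero)) as [Z|Z].
  - apply sub_zero in Z. destruct (small_unit L 1 GL) as [e [De [Ne [Pe _]]]]; [lra|].
    exists e. split; [assumption|split; [assumption|split; [assumption|]]].
    intros z Pz. rewrite Z. apply Zp. intros l Hl. apply Pz. right. assumption.
  - destruct (normalize _ Z) as [P1 P2]. set (q := d -v p) in *.
    exists (/ vnorm q *v q). split; [|split; [assumption|split]].
    + apply D_subsp, subsp_sub; assumption.
    + apply perp_scal, Pp.
    + intros z Pz. replace d with (p +v vnorm q *v (/ vnorm q *v q)).
      * rewrite ri_add_r, ri_scal_r. rewrite (Zp z) by (intros l Hl; apply Pz; right; assumption).
        rewrite (proj1 (Pz _ (or_introl eq_refl))). ring.
      * apply vext. intro y. autorewrite with ri. rewrite <- Rmult_assoc, Rinv_r by lra.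
        unfold q. autorewrite with ri. ring.
Qed.

Variable d : nat -> X.
Hypothesis d_dom : forall j, D (d j).
Hypothesis d_total : forall x, (forall j, ri x (d j) = 0) -> x = vzero.

(** Positions encode pairs: step (j, 0) captures [d j], which makes the family total, while steps
    (j, i) with i > 0 supply vectors of small [N]. *)
Lemma adapted_basis (eps : nat -> R) : (forall n, 0 < eps n) ->
  exists F : nat -> X,
    (forall n, D (F n) /\ vnorm (F n) = 1) /\
    (forall n m, n <> m -> ri (F n) (F m) = 0 /\ ri (F n) (J (F m)) = 0) /\
    (forall j i, i <> 0%nat -> N (F (to_nat (j, i))) <= eps (to_nat (j, i))) /\
    (forall z, (forall n, ri z (F n) = 0 /\ ri z (J (F n)) = 0) -> z = vzero).
Proof.
  intro Heps.
  (* [Q] is conditional on [good] so that choice yields a total function. [L n] below lists the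
     first [n] vectors, latest first, and is shown good by induction. *)
  set (Q := fun (s : nat * list X) e => good (snd s) ->
    D e /\ vnorm e = 1 /\ perp e (snd s) /\
    (snd (of_nat (fst s)) = 0%nat ->
       forall z, perp z (e :: snd s) -> ri z (d (fst (of_nat (fst s)))) = 0) /\
    (snd (of_nat (fst s)) <> 0%nat -> N e <= eps (fst s))).
  destruct (functional_choice Q) as [g Hg].
  { intros [n L]. unfold Q. simpl. destruct (classic (good L)) as [G|G].
    - destruct (Nat.eq_dec (snd (of_nat n)) 0) as [Z|Z].
      + destruct (capture_unit L (d (fst (of_nat n))) G (d_dom _)) as [e [A [B [C E]]]].
        exists e. intros _. repeat split; try assumption; try apply C; try assumption; try contradiction.
        intros. apply E. assumption.
      + destruct (small_unit L (eps n) G (Heps n)) as [e [A [B [C E]]]].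
        exists e. intros _. repeat split; try assumption; try apply C; try assumption; try contradiction.
        intros. exact E.
    - exists vzero. intro. contradiction. }
  set (L := fix L n := match n with O => nil | S n => g (n, L n) :: L n end).
  set (F := fun n => g (n, L n)).
  assert (GL : forall n, good (L n)).
  { induction n as [|n IH]; [apply good_nil|]. destruct (Hg (n, L n) IH) as [A [B [C _]]].
    simpl. apply good_cons; assumption. }
  assert (HL : forall n e, In e (L n) <-> exists m, (m < n)%nat /\ e = F m).
  { induction n as [|n IH]; intro e; simpl.
    - split; [intros []|intros [m [Hm _]]; lia].
    - rewrite IH. split.
      + intros [<-|[m [Hm ->]]]; [exists n; split; [lia|reflexivity]|exists m; split; [lia|reflexivity]].
      + intros [m [Hm ->]]. destruct (Nat.eq_dec m n) as [->|]; [left; reflexivity|].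
        right. exists m. split; [lia|reflexivity]. }
  assert (O : forall n m, (m < n)%nat -> ri (F n) (F m) = 0 /\ ri (F n) (J (F m)) = 0).
  { intros n m Hm. destruct (Hg (n, L n) (GL n)) as [_ [_ [C _]]]. apply C. apply HL.
    exists m. split; [assumption|reflexivity]. }
  exists F. split; [|split; [|split]].
  - intro n. destruct (Hg (n, L n) (GL n)) as [A [B _]]. split; assumption.
  - intros n m Hn. destruct (Nat.lt_trichotomy m n) as [Hm|[Hm|Hm]]; [apply O, Hm|lia|].
    destruct (O m n Hm) as [A B]. rewrite (ri_sym X (F n) (F m)), (ri_sym X (F n) (J (F m))), ri_J. split; lra.
  - intros j i Hi. destruct (Hg (to_nat (j, i), L (to_nat (j, i))) (GL _)) as [_ [_ [_ [_ C]]]].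
    apply C. cbn [fst snd]. rewrite cancel_of_to. exact Hi.
  - intros z Hz. apply d_total. intro j.
    destruct (Hg (to_nat (j, 0%nat), L (to_nat (j, 0%nat))) (GL _)) as [_ [_ [_ [C _]]]].
    cbn [fst snd] in C. rewrite cancel_of_to in C. apply C; [reflexivity|].
    intros e [<-|He]; [apply Hz|]. apply HL in He. destruct He as [m [_ ->]]. apply Hz.
Qed.

(** * Power-weighted sums and the transversal subspaces *)

Lemma pow_le_pow (t : R) (n m : nat) : 0 < t <= 1 -> (n <= m)%nat -> t ^ m <= t ^ n.
Proof.
  intros Ht L. replace m with (n + (m - n))%nat by lia. rewrite pow_add.
  assert (0 < t ^ n) by (apply pow_lt; lra).
  assert (t ^ (m - n) <= 1) by (rewrite <- (pow1 (m - n)); apply pow_incr; lra). nra.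
Qed.

(* [s] behaves like the sum of the series [t ^ (m + 1) *v u m]. *)
Definition power_sum (u : nat -> X) (t : R) (s : X) : Prop :=
  (forall z p, (forall m, (m < p)%nat -> ri z (u m) = 0) ->
     Rabs (ri z s - t ^ (p + 1) * ri z (u p)) <= 2 * t ^ (p + 2) * vnorm z) /\
  (forall z p, (forall m, m <> p -> ri z (u m) = 0) -> ri z s = t ^ (p + 1) * ri z (u p)).

Lemma power_sum_exists (u : nat -> X) t : (forall n, vnorm (u n) = 1) -> 0 < t <= / 2 ->
  exists s : X, power_sum u t s.
Proof.
  intros Hu Ht.
  set (P := fix P n := match n with O => (vzero : X) | S n => P n +v t ^ (n + 1) *v u n end).
  assert (PS : forall n, P (S n) = P n +v t ^ (n + 1) *v u n) by reflexivity.
  assert (P0 : P 0%nat = vzero) by reflexivity.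
  clearbody P.
  (* The subtracted term lets the induction close: t^m <= 2 t^m - 2 t^(m+1), because t <= 1/2. *)
  assert (B : forall n k, vnorm (P (k + n)%nat -v P n) <= 2 * t ^ (n + 1) - 2 * t ^ (k + n + 1)).
  { intros n k. induction k as [|k IH].
    - simpl. rewrite vadd_opp, vnorm_zero. lra.
    - change (S k + n)%nat with (S (k + n)). rewrite PS.
      replace (P (k + n)%nat +v t ^ (k + n + 1) *v u (k + n)%nat -v P n)
        with ((P (k + n)%nat -v P n) +v t ^ (k + n + 1) *v u (k + n)%nat) by vec.
      eapply Rle_trans; [apply vnorm_add|]. rewrite vnorm_scal, Hu.
      assert (0 < t ^ (k + n + 1)) by (apply pow_lt; lra). rewrite Rabs_pos_eq by lra.
      change (S (k + n) + 1)%nat with (S (k + n + 1)). rewrite <- tech_pow_Rmult. nra. }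
  assert (B' : forall n m, (n <= m)%nat -> vnorm (P m -v P n) <= 2 * t ^ (n + 1)).
  { intros n m L. specialize (B n (m - n)%nat). replace (m - n + n)%nat with m in B by lia.
    assert (0 < t ^ (m + 1)) by (apply pow_lt; lra). lra. }
  destruct (HC P) as [s Hs].
  { intros eps He. destruct (pow_lt_1_zero t) with (y := eps / 2) as [M HM];
      [rewrite Rabs_pos_eq; lra|lra|].
    exists M. intros n m Hn Hm. unfold vdist.
    assert (K : forall n m, (M <= n)%nat -> (n <= m)%nat -> vnorm (P m -v P n) < eps).
    { intros n' m' Hn' L. eapply Rle_lt_trans; [apply B', L|]. specialize (HM (n' + 1)%nat ltac:(lia)).
      assert (0 < t ^ (n' + 1)) by (apply pow_lt; lra). rewrite Rabs_pos_eq in HM; lra. }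
    destruct (Nat.le_ge_cases n m); [rewrite vnorm_sym|]; apply K; assumption. }
  assert (Hn : forall n, vnorm (s -v P n) <= 2 * t ^ (n + 1)).
  { intro n. apply (cv_norm_le X (fun m => P m -v P n)).
    - intros eps He. destruct (Hs eps He) as [M HM]. exists M. intros m Hm. unfold vdist in *.
      replace (P m -v P n -v (s -v P n)) with (P m -v s) by vec. apply HM, Hm.
    - exists n. apply B'. }
  assert (Z : forall z p, (forall m, (m < p)%nat -> ri z (u m) = 0) -> forall q, (q <= p)%nat -> ri z (P q) = 0).
  { intros z p Hz q. induction q as [|q IH]; intro L; rewrite ?P0, ?PS; autorewrite with ri; [reflexivity|].
    rewrite IH, Hz by lia. ring. }
  exists s. split.
  - intros z p Hz. pose proof (Z z p Hz p ltac:(lia)) as E.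
    replace (ri z s - t ^ (p + 1) * ri z (u p)) with (ri (s -v P (S p)) z).
    + eapply Rle_trans; [apply cauchy_schwarz_abs|].
      apply Rmult_le_compat_r; [apply vnorm_pos|].
      replace (p + 2)%nat with (S p + 1)%nat by lia. apply Hn.
    + rewrite PS. autorewrite with ri. rewrite !(ri_sym X _ z), E. ring.
  - intros z p Hz. eapply UL_sequence; [rewrite ri_sym; apply cv_ri, Hs|].
    intros eps He. exists (S p). intros n Hn'.
    replace (ri (P n) z) with (t ^ (p + 1) * ri z (u p)); [rewrite Rdist_eq; exact He|].
    rewrite (ri_sym X (P n) z). clear - PS P0 Hn' Hz. induction Hn' as [|n Hn' IH].
    + rewrite PS. autorewrite with ri.
      enough (E : forall q, (q <= p)%nat -> ri z (P q) = 0) by (rewrite E by lia; ring).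
      induction q; intro; rewrite ?P0, ?PS; autorewrite with ri; [reflexivity|]. rewrite IHq, Hz by lia. ring.
    + rewrite PS. autorewrite with ri. rewrite <- IH, (Hz n) by lia. ring.
Qed.

(** Row n of Z consists of powers of [rate n]: its entry m is [rate n ^ (m + 1)]. *)
Definition rate (n : nat) : R := (/ 2) ^ (n + 1).

Lemma rate_range n : 0 < rate n <= / 2.
Proof.
  unfold rate. split; [apply pow_lt; lra|]. rewrite <- (pow_1 (/ 2)) at 2. apply pow_le_pow; [lra|lia].
Qed.

(* If the first nonzero coefficient of [f] were the [p]-th one, [ri f (w n)] would be of exact
   order [rate n ^ (p + 1)], which is incompatible with the assumed decay. *)
Lemma moments_vanish (u v w : nat -> X) (f : X) (s c : R) : 0 < s -> 0 <= c ->
  (forall n, power_sum u (rate n) (w n)) ->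
  (forall n, (0 < n)%nat -> Rabs (ri f (v n)) <= c * (/ 2) ^ ((n + 1) * (n + 1))) ->
  (forall n, Rabs (ri f (v n)) = s * Rabs (ri f (w n))) ->
  forall p, ri f (u p) = 0.
Proof.
  intros Hs Hc A B E p. induction p as [p IH] using (well_founded_ind Nat.lt_wf_0).
  pose proof (vnorm_pos X f).
  set (K := c / s + 2 * vnorm f).
  assert (HK : 0 <= K).
  { unfold K. assert (0 <= c / s) by (apply Rmult_le_pos; [lra|left; apply Rinv_0_lt_compat; lra]). lra. }
  assert (P : forall n, (p < n)%nat -> Rabs (ri f (u p)) <= K * rate n).
  { intros n Hn. pose proof (proj1 (A n) f p IH) as A'. specialize (B n ltac:(lia)). rewrite E in B.
    pose proof (rate_range n) as Hr.
    (* As n > p, the exponent (n+1)(n+1) is at least (n+1)(p+2): the assumed decay beats the leading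
       order [rate n ^ (p + 1)] by a factor [rate n]. *)
    assert (T : (/ 2) ^ ((n + 1) * (n + 1)) <= rate n ^ (p + 2)).
    { unfold rate. rewrite <- pow_mult. apply pow_le_pow; [lra|nia]. }
    assert (W : Rabs (ri f (w n)) <= c / s * rate n ^ (p + 2)).
    { apply (Rmult_le_reg_l s); [lra|]. replace (s * (c / s * rate n ^ (p + 2))) with (c * rate n ^ (p + 2)) by (field; lra). nra. }
    assert (0 < rate n ^ (p + 1)) by (apply pow_lt; lra).
    apply (Rmult_le_reg_l (rate n ^ (p + 1))); [assumption|].
    rewrite <- (Rabs_pos_eq (rate n ^ (p + 1))) at 1 by lra. rewrite <- Rabs_mult.
    replace (p + 2)%nat with (S (p + 1)) in * by lia. rewrite <- tech_pow_Rmult in *.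
    pose proof (Rabs_triang (ri f (w n)) (- (ri f (w n) - rate n ^ (p + 1) * ri f (u p)))) as Tr.
    rewrite Rabs_Ropp in Tr.
    replace (ri f (w n) + - (ri f (w n) - rate n ^ (p + 1) * ri f (u p))) with (rate n ^ (p + 1) * ri f (u p)) in Tr by ring.
    unfold K. lra. }
  destruct (Req_dec (ri f (u p)) 0) as [Z|Z]; [assumption|exfalso].
  apply Rabs_pos_lt in Z. set (r := Rabs (ri f (u p))) in *.
  destruct (pow_lt_1_zero (/ 2)) with (y := r / (K + 1)) as [M HM];
    [rewrite Rabs_pos_eq; lra|apply Rdiv_lt_0_compat; lra|].
  specialize (P (p + M + 1)%nat ltac:(lia)). specialize (HM (p + M + 1 + 1)%nat ltac:(lia)).
  fold (rate (p + M + 1)) in HM. pose proof (rate_range (p + M + 1)) as Hr.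
  rewrite Rabs_pos_eq in HM by lra.
  apply (Rmult_lt_compat_l (K + 1)) in HM; [|lra].
  replace ((K + 1) * (r / (K + 1))) with r in HM by (field; lra). nra.
Qed.

(** [M k] is built with s = k + 1. The product of [kv k i n] and [l k' j m] is the difference of the
    two parameters times Z_{nm} when i = j, and 0 otherwise. It vanishes for k = k', which puts
    [kv k i n] in [M k]; for k <> k' and i = j it does not, which separates the subspaces. *)
Lemma transversal_subspaces : exists M : nat -> X -> Prop,
  (forall n, subsp (M n) /\ closed (M n) /\
     (forall x, M n x -> D x -> x = vzero) /\ (forall x, orth (M n) x -> D x -> x = vzero)) /\
  (forall n m, n <> m -> exists k l, M n k /\ orth (M m) l /\ ri k l <> 0).
Proof.
  destruct (adapted_basis (fun m => (/ 2) ^ ((m + 1) * (m + 1)))) as [F [HF [OF [SF TF]]]].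
  { intro. apply pow_lt. lra. }
  (* Each block j is split by the parity of the second index. No smallness is known for [a j 0], the
     vector capturing [d j], hence the condition [0 < n] in [DecA]. *)
  set (a := fun j n => F (to_nat (j, 2 * n)%nat)).
  set (b := fun j n => F (to_nat (j, 2 * n + 1)%nat)).
  assert (inj : forall p q, to_nat p = to_nat q -> p = q).
  { intros p q E. rewrite <- (cancel_of_to p), <- (cancel_of_to q), E. reflexivity. }
  assert (F1 : forall n, ri (F n) (F n) = 1) by (intro n; rewrite <- vnorm_sq, (proj2 (HF n)); ring).
  assert (Dec : forall f, D f -> exists c, 0 <= c /\ forall j i, (i <> 0)%nat ->
    Rabs (ri f (F (to_nat (j, i)))) <= c * (/ 2) ^ ((i + 1) * (i + 1))).
  { intros f Df. destruct (D_cont f Df) as [c [Hc B]]. exists c. split; [assumption|]. intros j i Hi.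
    rewrite ri_sym. eapply Rle_trans; [apply B|]. apply Rmult_le_compat_l; [assumption|].
    eapply Rle_trans; [apply SF, Hi|]. apply pow_le_pow; [lra|].
    pose proof (to_nat_non_decreasing j i). nia. }
  assert (DecA : forall f, D f -> exists c, 0 <= c /\ forall j n, (0 < n)%nat ->
    Rabs (ri f (a j n)) <= c * (/ 2) ^ ((n + 1) * (n + 1)) /\
    Rabs (ri f (b j n)) <= c * (/ 2) ^ ((n + 1) * (n + 1))).
  { intros f Df. destruct (Dec f Df) as [c [Hc B]]. exists c. split; [assumption|]. intros j n Hn.
    split; (eapply Rle_trans; [apply B; lia|]; apply Rmult_le_compat_l; [assumption|]; apply pow_le_pow; [lra|nia]). }
  assert (exA : forall p : nat * nat, exists s, power_sum (a (fst p)) (rate (snd p)) s).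
  { intros [j n]. apply power_sum_exists; [intro; apply HF|apply rate_range]. }
  assert (exB : forall p : nat * nat, exists s, power_sum (b (fst p)) (rate (snd p)) s).
  { intros [j n]. apply power_sum_exists; [intro; apply HF|apply rate_range]. }
  destruct (functional_choice _ exA) as [za' Hza']. destruct (functional_choice _ exB) as [zb' Hzb'].
  clear exA exB.
  set (za := fun j n => za' (j, n)). set (zb := fun j n => zb' (j, n)).
  assert (Hza : forall j n, power_sum (a j) (rate n) (za j n)) by (intros; apply (Hza' (j, n))).
  assert (Hzb : forall j n, power_sum (b j) (rate n) (zb j n)) by (intros; apply (Hzb' (j, n))).
  clearbody za zb. clear za' zb' Hza' Hzb'.
  assert (zero_sum : forall u t s z, power_sum u t s -> (forall m, ri z (u m) = 0) -> ri z s = 0).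
  { intros u t s z [_ Hs] Hz. rewrite (Hs z 0%nat) by (intros; apply Hz). rewrite Hz. ring. }
  assert (OJ : forall n m, ri (F n) (J (F m)) = 0).
  { intros n m. destruct (Nat.eq_dec n m) as [->|Hn]; [apply ri_J_self|apply OF, Hn]. }
  assert (OJ' : forall n m, ri (J (F n)) (F m) = 0) by (intros; rewrite ri_J, OJ; ring).
  assert (Oab : forall i n j m, ri (a i n) (b j m) = 0).
  { intros. apply OF. intro E. apply inj in E. injection E. lia. }
  set (dl := fun i j : nat => if Nat.eq_dec i j then 1 else 0).
  assert (Ga : forall i n j m, ri (a i n) (za j m) = rate m ^ (n + 1) * dl i j).
  { intros. rewrite (proj2 (Hza j m) _ n).
    - unfold dl. destruct (Nat.eq_dec i j) as [->|Hi]; [unfold a; rewrite F1; reflexivity|].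
      apply Rmult_eq_compat_l, OF. intro E. apply inj in E. injection E. lia.
    - intros q Hq. apply OF. intro E. apply inj in E. injection E. lia. }
  assert (Gb : forall i n j m, ri (b i n) (zb j m) = rate m ^ (n + 1) * dl i j).
  { intros. rewrite (proj2 (Hzb j m) _ n).
    - unfold dl. destruct (Nat.eq_dec i j) as [->|Hi]; [unfold b; rewrite F1; reflexivity|].
      apply Rmult_eq_compat_l, OF. intro E. apply inj in E. injection E. lia.
    - intros q Hq. apply OF. intro E. apply inj in E. injection E. lia. }
  assert (dl_sym : forall i j, dl i j = dl j i).
  { intros. unfold dl. destruct (Nat.eq_dec i j), (Nat.eq_dec j i); congruence. }
  (* Symmetry of Z, which cancels the cross terms between [kv] and [l] for equal parameters. *)
  assert (rate_sym : forall n m, rate m ^ (n + 1) = rate n ^ (m + 1)).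
  { intros. unfold rate. rewrite <- !pow_mult. f_equal. ring. }
  assert (Ozz : forall i n j m, ri (zb i n) (za j m) = 0).
  { intros. apply (zero_sum (a j) (rate m)); [apply Hza|]. intro q. rewrite ri_sym.
    apply (zero_sum (b i) (rate n)); [apply Hzb|]. intro. apply Oab. }
  assert (OzzJ : forall i n j m, ri (zb i n) (J (za j m)) = 0).
  { intros. rewrite <- (Ropp_involutive (ri _ _)), <- ri_J. apply Ropp_eq_0_compat.
    apply (zero_sum (a j) (rate m)); [apply Hza|]. intro q. rewrite ri_J.
    apply Ropp_eq_0_compat. rewrite ri_sym.
    apply (zero_sum (b i) (rate n)); [apply Hzb|]. intro. apply OJ'. }
  assert (OzaJ : forall i n j m, ri (a i n) (J (za j m)) = 0).
  { intros. rewrite <- (Ropp_involutive (ri _ _)), <- ri_J. apply Ropp_eq_0_compat.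
    apply (zero_sum (a j) (rate m)); [apply Hza|]. intro q. apply OJ'. }
  assert (OzbJ : forall i n j m, ri (zb i n) (J (b j m)) = 0).
  { intros. rewrite ri_sym. apply (zero_sum (b i) (rate n)); [apply Hzb|]. intro q. apply OJ'. }
  set (sc := fun k : nat => INR k + 1).
  assert (sc_pos : forall k, 0 < sc k) by (intro k; unfold sc; pose proof (pos_INR k); lra).
  set (l := fun k j n => b j n -v sc k *v za j n).
  set (kv := fun k j n => a j n +v sc k *v zb j n).
  assert (Hkl : forall k k' i n j m, ri (kv k i n) (l k' j m) = (sc k - sc k') * (rate m ^ (n + 1) * dl i j)).
  { intros. unfold kv, l. autorewrite with ri.
    rewrite Oab, Ozz, Ga, (ri_sym X (zb i n)), Gb, (dl_sym j i), (rate_sym m n). ring. }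
  assert (J_sub : forall c (x y : X), J (x -v c *v y) = J x -v c *v J y).
  { intros. apply vext. intro. rewrite ri_J. autorewrite with ri. rewrite !ri_J. ring. }
  assert (HklJ : forall k k' i n j m, ri (kv k i n) (J (l k' j m)) = 0).
  { intros. unfold kv, l. rewrite J_sub. autorewrite with ri.
    rewrite OzaJ, OzzJ, OzbJ, (OJ (to_nat (i, (2 * n)%nat)) (to_nat (j, (2 * m + 1)%nat)) : ri (a i n) (J (b j m)) = 0). ring. }
  (* Including the multiples by [J] makes this real orthogonal complement a complex subspace. *)
  set (M := fun k => orth (fun y => exists j n, y = l k j n \/ y = J (l k j n))).
  assert (SM : forall k, subsp (M k)).
  { intro k. split; [|split].
    - intros m _. apply ri_zero_l.
    - intros x y Hx Hy m Hm. rewrite ri_add_l, Hx, Hy by assumption. ring.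
    - intros c x Hx m [j [n [->| ->]]]; rewrite vscal_ri, ?ri_J_J, ?ri_J, !Hx; try ring;
        exists j, n; (left; reflexivity) || (right; reflexivity). }
  assert (Mkv : forall k i n, M k (kv k i n)).
  { intros k i n y [j [m [->| ->]]]; [rewrite Hkl; ring|apply HklJ]. }
  assert (Ml : forall k j n, orth (M k) (l k j n)).
  { intros k j n y Hy. rewrite ri_sym. apply Hy. exists j, n. left. reflexivity. }
  assert (Tot : forall x, (forall j n, (ri x (a j n) = 0 /\ ri x (b j n) = 0) /\
      (ri (J x) (a j n) = 0 /\ ri (J x) (b j n) = 0)) -> x = vzero).
  { intros x Hx. apply TF. intro q. rewrite <- (cancel_to_of q). destruct (of_nat q) as [j i].
    assert (G : exists n, (i = 2 * n \/ i = 2 * n + 1)%nat).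
    { destruct (Nat.Even_or_Odd i) as [[n Hn]|[n Hn]]; exists n; lia. }
    destruct G as [n G]. destruct (Hx j n) as [[A B] [A' B']]. rewrite ri_J in A', B'.
    unfold a, b in *. destruct G as [-> | ->]; split; lra. }
  exists M. split.
  - intro k. split; [apply SM|split; [apply orth_closed|split]].
    (* The b-coefficients of [f] are s times its products with [za] and decay fast, so
       [moments_vanish] kills the a-coefficients, and then the b-coefficients vanish as well. *)
    + assert (Key : forall f, D f -> (forall j n, ri f (l k j n) = 0) -> forall j n, ri f (a j n) = 0 /\ ri f (b j n) = 0).
      { intros f Df Hf. destruct (DecA f Df) as [c [Hc B]].
        assert (E : forall j n, ri f (b j n) = sc k * ri f (za j n)).
        { intros j n. specialize (Hf j n). unfold l in Hf. autorewrite with ri in Hf. lra. }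
        assert (A : forall j n, ri f (a j n) = 0).
        { intro j. apply (moments_vanish (a j) (b j) (za j) f (sc k) c); auto.
          - intros n Hn. apply B, Hn.
          - intro n. rewrite E, Rabs_mult, (Rabs_pos_eq (sc k)) by (left; apply sc_pos). reflexivity. }
        intros j n. split; [apply A|]. rewrite E, (zero_sum (a j) (rate n) (za j n)); auto. ring. }
      intros x Mx Dx. apply Tot. intros j n. split; apply Key; auto.
      * intros i m. apply Mx. exists i, m. left. reflexivity.
      * apply D_subsp, Dx.
      * intros i m. rewrite ri_J, (Mx (J (l k i m))); [ring|]. exists i, m. right. reflexivity.
    (* The same argument with a and b exchanged; the complement of [M k] is orthogonal to every
       [kv k i n]. *)
    + assert (Key : forall f, D f -> (forall j n, ri f (kv k j n) = 0) -> forall j n, ri f (a j n) = 0 /\ ri f (b j n) = 0).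
      { intros f Df Hf. destruct (DecA f Df) as [c [Hc B]].
        assert (E : forall j n, ri f (a j n) = - (sc k * ri f (zb j n))).
        { intros j n. specialize (Hf j n). unfold kv in Hf. autorewrite with ri in Hf. lra. }
        assert (A : forall j n, ri f (b j n) = 0).
        { intro j. apply (moments_vanish (b j) (a j) (zb j) f (sc k) c); auto.
          - intros n Hn. apply B, Hn.
          - intro n. rewrite E, Rabs_Ropp, Rabs_mult, (Rabs_pos_eq (sc k)) by (left; apply sc_pos). reflexivity. }
        intros j n. split; [|apply A]. rewrite E, (zero_sum (b j) (rate n) (zb j n)); auto. ring. }
      intros x Ox Dx. apply Tot. intros j n. split; apply Key; auto.
      * apply D_subsp, Dx.
      * intros i m. rewrite ri_J, (Ox (J (kv k i m))); [ring|]. apply SM, Mkv.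
  - intros k k' Hk. exists (kv k 0%nat 0%nat), (l k' 0%nat 0%nat).
    split; [apply Mkv|split; [apply Ml|]]. rewrite Hkl. unfold dl, sc, rate. simpl.
    apply not_INR in Hk. lra.
Qed.

End Basis.

(** * Form domain and restriction of the form *)

Section FormDomain.
Variable H : PreHilbert.
Variable S : op H.
Hypothesis LS : linear_op S.

Let X : Type := {x : H | dom S x}.

Lemma form_ext (x y : X) : proj1_sig x = proj1_sig y -> x = y.
Proof.
  destruct x as [x px], y as [y py]. simpl. intros ->. f_equal. apply proof_irrelevance.
Qed.

(** The graph inner product of [S]. The definition is transparent so that [val] commutes with the
    operations by computation. *)
Definition form_space : PreHilbert.
Proof.
  pose proof (dom_subsp H S LS) as D.
  refine (@Build_PreHilbert X (exist _ vzero (proj1 D))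
    (fun x y => exist _ (proj1_sig x +v proj1_sig y) (proj1 (proj2 D) _ _ (proj2_sig x) (proj2_sig y)))
    (fun x => exist _ (vopp (proj1_sig x)) (subsp_opp H _ _ D (proj2_sig x)))
    (fun c x => exist _ (vscal c (proj1_sig x)) (proj2 (proj2 D) c _ (proj2_sig x)))
    (fun x y => Cadd (inner (ap S (proj1_sig x)) (ap S (proj1_sig y))) (inner (proj1_sig x) (proj1_sig y)))
    _ _ _ _ _ _ _ _ _ _ _ _ _).
  - intros. apply form_ext, vadd_assoc.
  - intros. apply form_ext, vadd_comm.
  - intros. apply form_ext, vadd_zero.
  - intros. apply form_ext, vadd_opp.
  - intros. apply form_ext, vscal_one.
  - intros. apply form_ext, vscal_assoc.
  - intros. apply form_ext, vscal_distr_v.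
  - intros. apply form_ext, vscal_distr_s.
  - intros x y. rewrite (inner_conj H (ap S (proj1_sig x))), (inner_conj H (proj1_sig x)).
    apply C_ext; simpl; ring.
  - intros x y z. simpl. rewrite ap_add, !inner_add_l by (assumption || apply proj2_sig).
    apply C_ext; simpl; ring.
  - intros c x y. simpl. rewrite ap_scal, !inner_scal_l by (assumption || apply proj2_sig).
    apply C_ext; simpl; ring.
  - intro x. simpl. pose proof (inner_pos H (ap S (proj1_sig x))). pose proof (inner_pos H (proj1_sig x)). lra.
  - intros x E. apply form_ext. simpl. apply ri_def. apply (f_equal Re) in E. simpl in E.
    pose proof (inner_pos H (ap S (proj1_sig x))). pose proof (inner_pos H (proj1_sig x)). unfold ri. lra.
Defined.

Definition val (x : form_space) : H := proj1_sig x.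

Lemma val_dom x : dom S (val x).
Proof. exact (proj2_sig x). Qed.

Lemma val_sub x y : val (x -v y) = val x -v val y.
Proof. reflexivity. Qed.

Lemma val_inj x y : val x = val y -> x = y.
Proof. apply form_ext. Qed.

Lemma ri_form (x y : form_space) : ri x y = ri (ap S (val x)) (ap S (val y)) + ri (val x) (val y).
Proof. reflexivity. Qed.

Lemma vnorm_val x : vnorm (val x) <= vnorm x.
Proof.
  apply vnorm_le; [apply vnorm_pos|]. rewrite vnorm_sq, ri_form.
  pose proof (ri_pos H (ap S (val x))). lra.
Qed.

Lemma vnorm_ap x : vnorm (ap S (val x)) <= vnorm x.
Proof.
  apply vnorm_le; [apply vnorm_pos|]. rewrite vnorm_sq, ri_form.
  pose proof (ri_pos H (val x)). lra.
Qed.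

Lemma vnorm_form x : vnorm x <= vnorm (ap S (val x)) + vnorm (val x).
Proof.
  pose proof (vnorm_pos H (ap S (val x))). pose proof (vnorm_pos H (val x)).
  apply vnorm_le; [lra|]. rewrite ri_form, <- !vnorm_sq. nra.
Qed.

Lemma cv_val u x : converges_to form_space u x -> converges_to H (fun n => val (u n)) (val x).
Proof.
  apply (cv_lip form_space H u x val 1). intros. rewrite <- val_sub, Rmult_1_l. apply vnorm_val.
Qed.

(** A sequence Cauchy for the form norm is Cauchy in [H] together with its images under [S], and the
    graph of [S] is closed. *)
Lemma form_space_complete : complete H -> self_adjoint S -> complete form_space.
Proof.
  intros HC SA u Cu.
  destruct (HC (fun n => val (u n))) as [x Hx].
  { apply (cauchy_lip form_space H u _ 1); [lra| |assumption].
    intros. rewrite <- val_sub, Rmult_1_l. apply vnorm_val. }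
  destruct (HC (fun n => ap S (val (u n)))) as [y Hy].
  { apply (cauchy_lip form_space H u _ 1); [lra| |assumption].
    intros. rewrite <- ap_sub, <- val_sub, Rmult_1_l by (assumption || apply val_dom). apply vnorm_ap. }
  destruct (sa_closed H S _ x y SA (fun n => val_dom (u n)) Hx Hy) as [Dx Ey].
  exists (exist _ x Dx). intros eps He.
  destruct (Hx (eps / 2)) as [N HN]; [lra|]. destruct (Hy (eps / 2)) as [M HM]; [lra|].
  exists (N + M)%nat. intros n Hn. specialize (HN n ltac:(lia)). specialize (HM n ltac:(lia)).
  unfold vdist in *. eapply Rle_lt_trans; [apply vnorm_form|].
  rewrite val_sub, ap_sub by (assumption || apply val_dom).
  change (val (exist _ x Dx)) with x. rewrite <- Ey. lra.
Qed.

End FormDomain.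

Lemma dense_bound (H : PreHilbert) (W : H -> Prop) (z : H) k : dense H W -> 0 <= k ->
  (forall y, W y -> ri z y <= k * vnorm y) -> vnorm z <= k.
Proof.
  intros D Hk B. pose proof (vnorm_pos H z).
  assert (E : vnorm z * vnorm z <= k * vnorm z).
  { apply le_epsilon. intros eps He. set (e := eps / (vnorm z + k + 1)).
    assert (0 < e) by (apply Rdiv_lt_0_compat; lra).
    assert (Ee : e * (vnorm z + k + 1) = eps) by (unfold e; field; lra).
    destruct (D z e) as [y [Wy Dy]]; [assumption|]. unfold vdist in Dy. specialize (B y Wy).
    pose proof (cauchy_schwarz H z (z -v y)) as Q. autorewrite with ri in Q.
    pose proof (vnorm_sub H z (z -v y)) as V. replace (z -v (z -v y)) with y in V by vec.
    rewrite vnorm_sq. nra. }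
  destruct (Req_dec (vnorm z) 0); nra.
Qed.

(** * Operators attached to closed subspaces of the form domain *)

Section Restriction.
Variable H : PreHilbert.
Variables T S : op H.
Hypothesis HC : complete H.
Hypothesis HT : nonneg_self_adjoint T.
Hypothesis TU : unbounded T.
Hypothesis HS : is_sqrt S T.

Let SA : self_adjoint S := proj1 (proj1 HS).
Let LS : linear_op S := sa_lin H S SA.
Local Notation X := (form_space H S LS).
Local Notation val := (val H S LS).

Lemma sqrt_form x y : dom T x -> dom S y -> ri (ap S x) (ap S y) = ri (ap T x) y.
Proof.
  intros Dx Dy. pose proof HS as [_ [E F]]. rewrite F by assumption.
  symmetry. apply sa_symm; [exact SA|apply E, Dx|exact Dy].
Qed.

(** [A h] is (1+T)^{-1} h, which is the Riesz representative of the functional (h, .) for the form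
    inner product. *)
Lemma form_resolvent : exists A : H -> X, forall h, dom T (val (A h)) /\
  ap T (val (A h)) = h -v val (A h) /\ forall m, ri (A h) m = ri h (val m).
Proof.
  destruct (resolvent H T HC HT) as [A HA].
  assert (DS : forall h, dom S (A h)) by (intro h; apply HS, HA).
  exists (fun h => exist _ (A h) (DS h)). intro h. destruct (HA h) as [D E].
  split; [exact D|split; [exact E|]]. intro m. rewrite ri_form.
  change (val (exist _ (A h) (DS h))) with (A h).
  rewrite sqrt_form, E by (apply D || apply val_dom). autorewrite with ri. ring.
Qed.

(** The last clause makes dom T1 total in [M]; it serves to tell apart the operators built from
    different subspaces. *)
Definition form_restriction (M : X -> Prop) (T1 S1 : op H) : Prop :=
  nonneg_self_adjoint T1 /\ unbounded T1 /\ is_sqrt S1 T1 /\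
  (forall x, dom S1 x <-> exists m, M m /\ val m = x) /\
  (forall g, dom S1 g -> vnorm (ap S1 g) = vnorm (ap S g)) /\
  (forall q, (forall x, dom T1 (val x) -> ri q x = 0) -> orth M q).

Section Subspace.
Variable M : X -> Prop.
Hypothesis SM : subsp M.
Hypothesis CM : closed M.
Hypothesis M_dom : forall x, M x -> dom T (val x) -> x = vzero.
Hypothesis orth_dom : forall x, orth M x -> dom T (val x) -> x = vzero.

(** If [h] is orthogonal to [M] in [H], then [A h] is form-orthogonal to [M] and lies in dom T,
    hence is zero. So [M] is dense in [H], and [r] below is injective. *)
Lemma M_total h : (forall m, M m -> ri h (val m) = 0) -> h = vzero.
Proof.
  destruct form_resolvent as [A HA]. destruct (HA h) as [D [E F]]. intro Z.
  assert (A0 : A h = vzero).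
  { apply orth_dom; [|assumption]. intros m Hm. rewrite F. apply Z, Hm. }
  rewrite A0 in E. change (val vzero) with (vzero : H) in E.
  replace h with (h -v vzero) by vec. rewrite <- E.
  replace (vzero : H) with (vscal (mkC 0 0) (vzero : H)) at 1 by vec.
  rewrite ap_scal; [vec|apply HT|]. apply dom_subsp, sa_lin, HT.
Qed.

(** [R h] is the form projection of (1+T)^{-1} h on [M], which represents (h, .) on [M]; uniqueness
    of the representative gives linearity. *)
Lemma compressed_resolvent : exists R : H -> X,
  lin R /\ forall h, M (R h) /\ forall m, M m -> ri (R h) m = ri h (val m).
Proof.
  destruct form_resolvent as [A HA].
  destruct (functional_choice _ (fun h => projection X M (A h)
    (form_space_complete H S LS HC SA) SM CM)) as [R HR].
  assert (E : forall h m, M m -> ri (R h) m = ri h (val m)).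
  { intros h m Hm. destruct (HR h) as [_ O]. specialize (O m Hm).
    autorewrite with ri in O. rewrite <- (proj2 (proj2 (HA h))). lra. }
  assert (U : forall p q, M p -> M q -> (forall m, M m -> ri p m = ri q m) -> p = q).
  { intros p q Mp Mq Q. apply sub_zero, ri_def. rewrite ri_add_l, ri_opp_l, Q; [ring|].
    apply subsp_sub; assumption. }
  exists R. split; [|intro h; split; [apply HR|intros; apply E; assumption]].
  split.
  - intros x y. apply U; [apply HR|apply SM; apply HR|]. intros m Hm.
    rewrite ri_add_l, !E, ri_add_l by assumption. reflexivity.
  - intros c x. apply U; [apply HR|apply SM; apply HR|]. intros m Hm.
    rewrite vscal_ri, ri_J, !E, vscal_ri, ri_J by (assumption || apply SM, Hm). reflexivity.
Qed.

(** [r] is [R] seen in [H], with B = r^{1/2} and C = (1 - r)^{1/2}; then T1 = r^{-1} - 1 and S1 = C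
    B^{-1}. The key fact is that [B] maps [H] isometrically onto [M] with the form norm. This gives
    dom S1 and, as |y|^2 = |C y|^2 + |B y|^2, the norm identity. *)
Lemma restricted_operator : exists T1 S1 : op H, form_restriction M T1 S1.
Proof.
  pose proof (form_space_complete H S LS HC SA : complete X) as XC.
  destruct compressed_resolvent as [R [LR HR]].
  set (r := fun h => val (R h)).
  assert (Lr : lin r).
  { split; intros; unfold r; [rewrite (proj1 LR)|rewrite (proj2 LR)]; reflexivity. }
  assert (Rr : forall h k, ri (R h) (R k) = ri h (r k)) by (intros; apply HR, HR).
  assert (Sr : symm r).
  { intros x y. rewrite <- Rr, (ri_sym H _ y), <- Rr. apply ri_sym. }
  assert (Nr : forall h, ri (r h) (r h) <= ri h (r h)).
  { intro h. rewrite <- (Rr h h), <- !vnorm_sq. pose proof (vnorm_val H S LS (R h)).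
    pose proof (vnorm_pos H (val (R h))). fold (r h) in *. nra. }
  assert (r0 : forall h, r h = vzero -> h = vzero).
  { intros h E. apply M_total. intros m Hm. rewrite <- (proj2 (HR h)) by assumption.
    replace (R h) with (vzero : X); [apply ri_zero_l|]. apply (val_inj H S LS). symmetry. exact E. }
  assert (Cr : forall h, vnorm (r h) <= vnorm h).
  { intro h. specialize (Nr h). pose proof (cauchy_schwarz H h (r h)). rewrite <- vnorm_sq in Nr.
    pose proof (vnorm_pos H h). pose proof (vnorm_pos H (r h)).
    destruct (Req_dec (vnorm (r h)) 0); nra. }
  assert (Cf : forall h, vnorm (h -v r h) <= vnorm h).
  { intro h. apply vnorm_le; [apply vnorm_pos|]. rewrite vnorm_sq. specialize (Nr h).
    pose proof (ri_pos H (r h)). autorewrite with ri. rewrite (ri_sym H (r h) h). lra. }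
  assert (Lid : forall g : H -> H, lin g -> lin (fun x => x -v g x)).
  { intros g [A B]. split; intros.
    - rewrite A. vec.
    - rewrite B. apply vext. intro. autorewrite with ri. rewrite !vscal_ri, !ri_J. autorewrite with ri. ring. }
  assert (Sid : forall g : H -> H, symm g -> symm (fun x => x -v g x)).
  { intros g A x y. autorewrite with ri. rewrite A. reflexivity. }
  (* As [square_root] returns the root of 1 - f, the choices f = 1 - r, r and 1 - B give B, C and D
     = B^{1/2}; the last serves the non-negativity of [S1]. *)
  destruct (square_root H (fun h => h -v r h) HC (Lid r Lr) (Sid r Sr) Cf)
    as [B [LB [SB [PB [EB [CB _]]]]]].
  destruct (square_root H r HC Lr Sr Cr) as [C [LC [SC [PC [EC [CC KC]]]]]].
  destruct (square_root H (fun h => h -v B h) HC (Lid B LB) (Sid B SB) CB)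
    as [D [LD [SD [_ [ED [_ KD]]]]]].
  assert (EB' : forall x, B (B x) = r x) by (intro; rewrite EB; vec).
  assert (ED' : forall x, D (D x) = B x) by (intro; rewrite ED; vec).
  assert (two : forall g : H -> H, (forall x, vnorm (x -v g x) <= vnorm x) -> forall x, vnorm (g x) <= 2 * vnorm x).
  { intros g Hg x. replace (g x) with (x -v (x -v g x)) by vec.
    pose proof (vnorm_sub H x (x -v g x)). specialize (Hg x). lra. }
  assert (KBC : forall x, B (C x) = C (B x)).
  { apply (KC B 2); [assumption|apply two, CB|]. intro. rewrite <- !EB'. reflexivity. }
  assert (KCD : forall x, C (D x) = D (C x)).
  { apply (KD C 2); [assumption|apply two, CC|]. intro. rewrite lin_sub, KBC by assumption. reflexivity. }
  assert (B0 : forall x, B x = vzero -> x = vzero).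
  { intros x E. apply r0. rewrite <- EB', E. apply lin_zero, LB. }
  assert (inj : forall g : H -> H, lin g -> (forall x, g x = vzero -> x = vzero) -> forall x y, g x = g y -> x = y).
  { intros g L Z x y E. apply sub_zero, Z. rewrite lin_sub, E by assumption. apply vadd_opp. }
  assert (ran_subsp : forall g : H -> H, lin g -> subsp (fun x => exists y, x = g y)).
  { intros g [A Z]. split; [|split].
    - exists (vscal (mkC 0 0) vzero). rewrite Z. vec.
    - intros x y [x' ->] [y' ->]. exists (x' +v y'). rewrite A. reflexivity.
    - intros c x [x' ->]. exists (vscal c x'). rewrite Z. reflexivity. }
  assert (ran_dense : forall g : H -> H, lin g -> symm g -> (forall x, g x = vzero -> x = vzero) ->
    dense H (fun x => exists y, x = g y)).
  { intros g L Sg Z. apply dense_orth; [assumption|apply ran_subsp, L|].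
    intros z Oz. apply Z, vext. intro w. rewrite Sg, ri_zero_l. apply Oz. exists w. reflexivity. }
  assert (BM : forall y, exists m, M m /\ val m = B y /\ ri m m = ri y y).
  { (* [R] maps [x] isometrically to the element [B (B x)] of [M], up to the norm of [B x]. *)
    intro y. destruct (dense_seq H _ y (ran_dense B LB SB B0)) as [u [Hu Cu]].
    destruct (functional_choice _ Hu) as [x Hx].
    destruct (XC (fun n => R (x n))) as [m Hm].
    { apply (cauchy_lip H X u _ 1); [lra| |apply (cv_cauchy H u y Cu)].
      intros n k. right. rewrite Rmult_1_l. apply vnorm_eq; [apply vnorm_pos|].
      rewrite <- lin_sub, Rr, <- EB', <- SB, lin_sub, !Hx by assumption. symmetry. apply vnorm_sq. }
    exists m. split; [apply (CM _ m (fun n => proj1 (HR (x n))) Hm)|].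
    assert (Em : val m = B y).
    { apply (cv_eq H (fun n => val (R (x n)))); [apply cv_val, Hm|].
      intros eps He. destruct (cv_lip H H u y B 2) with (eps := eps) as [N HN]; [|assumption|assumption|].
      - intros. rewrite <- lin_sub by assumption. apply two, CB.
      - exists N. intros n Hn. fold (r (x n)). rewrite <- EB', <- Hx. apply HN, Hn. }
    split; [exact Em|].
    eapply UL_sequence; [apply cv_ri, Hm|]. intros eps He.
    destruct (cv_ri H u y y Cu eps He) as [N HN]. exists N. intros n Hn.
    replace (ri (R (x n)) m) with (ri (u n) y); [apply HN, Hn|].
    rewrite (proj2 (HR (x n)) m (CM _ m (fun n => proj1 (HR (x n))) Hm)), Em, <- SB, <- Hx. reflexivity. }
  assert (BMeq : forall y m, val m = B y -> M m /\ ri m m = ri y y).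
  { intros y m E. destruct (BM y) as [m' [Mm [E' I]]].
    replace m with m' by (apply (val_inj H S LS); congruence). split; assumption. }
  assert (MB : forall m, M m -> exists y, val m = B y).
  (* [W] is closed by the isometry. A vector of [M] form-orthogonal to [W] is form-orthogonal to
     every [R h], hence orthogonal in [H] to every [h], and vanishes. *)
  { set (W := fun m : X => exists y, val m = B y).
    assert (SW : subsp W).
    { split; [|split].
      - exists vzero. symmetry. apply lin_zero, LB.
      - intros m k [y Ey] [z Ez]. exists (y +v z). rewrite (proj1 LB), <- Ey, <- Ez. reflexivity.
      - intros c m [y Ey]. exists (vscal c y). rewrite (proj2 LB), <- Ey. reflexivity. }
    assert (CW : closed W).
    { intros w l Hw Cw. destruct (functional_choice _ Hw) as [y Hy].
      destruct (HC y) as [z Hz].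
      { apply (cauchy_lip X H w y 1); [lra| |apply (cv_cauchy X w l Cw)].
        intros n k. right. rewrite Rmult_1_l. apply vnorm_eq; [apply vnorm_pos|].
        rewrite vnorm_sq. symmetry. apply BMeq.
        rewrite val_sub, (lin_sub _ _ B), <- !Hy by assumption. reflexivity. }
      exists z. apply (cv_eq H (fun n => val (w n))); [apply cv_val, Cw|].
      intros eps He. destruct (cv_lip H H y z B 2) with (eps := eps) as [N HN]; [|assumption|assumption|].
      - intros. rewrite <- lin_sub by assumption. apply two, CB.
      - exists N. intros n Hn. rewrite Hy. apply HN, Hn. }
    intros m Mm. destruct (projection X W m XC SW CW) as [p [[y Ey] Op]].
    exists y. rewrite <- Ey. f_equal. apply sub_zero, (val_inj H S LS), vext. intro h.
    change (val vzero) with (vzero : H). rewrite ri_zero_l, ri_sym, <- (proj2 (HR h)).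
    - rewrite ri_sym. apply Op. exists (B h). rewrite EB'. reflexivity.
    - apply subsp_sub; [exact SM|exact Mm|]. apply (BMeq y p Ey). }
  (* The inverses of [B] and [r] become total functions, specified on the ranges only. *)
  destruct (functional_choice (fun x y => (exists z, x = B z) -> x = B y)) as [Binv HBi].
  { intro x. destruct (classic (exists z, x = B z)) as [[z Hz]|N]; [exists z; auto|exists vzero; contradiction]. }
  destruct (functional_choice (fun x y => (exists z, x = r z) -> x = r y)) as [rinv Hri].
  { intro x. destruct (classic (exists z, x = r z)) as [[z Hz]|N]; [exists z; auto|exists vzero; contradiction]. }
  assert (BinvB : forall y, Binv (B y) = y).
  { intro y. apply (inj B LB B0). symmetry. apply HBi. exists y. reflexivity. }
  assert (rinvr : forall y, rinv (r y) = y).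
  { intro y. apply (inj r Lr r0). symmetry. apply Hri. exists y. reflexivity. }
  clear HBi Hri.
  set (T1 := {| dom := fun x => exists h, x = r h; ap := fun x => rinv x -v x |}).
  set (S1 := {| dom := fun x => exists y, x = B y; ap := fun x => C (Binv x) |}).
  assert (apS : forall y, ap S1 (B y) = C y) by (intro; simpl; rewrite BinvB; reflexivity).
  assert (apT : forall h, ap T1 (r h) = h -v r h) by (intro; simpl; rewrite rinvr; reflexivity).
  assert (ST1 : self_adjoint T1).
  { apply sa_intro.
    - pose proof (ran_subsp r Lr) as [Z [A Sc]]. split; [exact Z|split].
      + intros x y Hx Hy. split; [apply A; assumption|]. destruct Hx as [h ->], Hy as [k ->].
        rewrite <- (proj1 Lr), !apT, (proj1 Lr). vec.
      + intros c x Hx. split; [apply Sc; assumption|]. destruct Hx as [h ->].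
        rewrite <- (proj2 Lr), !apT. apply (Lid r Lr).
    - apply ran_dense; assumption.
    - intros x y [h ->] [k ->]. rewrite !apT. autorewrite with ri. rewrite (Sr h k). reflexivity.
    - intros y z E.
      (* The adjoint condition reads (h - r h, y) = (r h, z) for all h, that is, y - r y = r z. *)
      assert (Y : y = r (y +v z)).
      { rewrite (proj1 Lr). apply vext. intro h.
        specialize (E (r h) (ex_intro _ h eq_refl)). rewrite apT in E. autorewrite with ri in *.
        rewrite !Sr, (ri_sym H y h), (ri_sym H y (r h)), (ri_sym H z (r h)). lra. }
      split; [exists (y +v z); exact Y|]. rewrite Y at 1. rewrite apT, <- Y. vec. }
  assert (SS1 : self_adjoint S1).
  { apply sa_intro.
    - pose proof (ran_subsp B LB) as [Z [A Sc]]. split; [exact Z|split].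
      + intros x y Hx Hy. split; [apply A; assumption|]. destruct Hx as [h ->], Hy as [k ->].
        rewrite <- (proj1 LB), !apS. apply LC.
      + intros c x Hx. split; [apply Sc; assumption|]. destruct Hx as [h ->].
        rewrite <- (proj2 LB), !apS. apply LC.
    - apply ran_dense; assumption.
    - intros x y [h ->] [k ->]. rewrite !apS, SC, SB, KBC. reflexivity.
    - intros y z E.
      (* The adjoint condition becomes C y = B z; inserted into y = B B y + C C y, it exhibits [y]
         in the range of [B]. *)
      assert (CB' : C y = B z).
      { apply vext. intro h. specialize (E (B h) (ex_intro _ h eq_refl)).
        rewrite apS, SC, SB in E. rewrite !(ri_sym H _ h). exact E. }
      assert (Y : y = B (B y +v C z)).
      { rewrite (proj1 LB), EB', KBC, <- CB', EC. vec. }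
      split; [exists (B y +v C z); exact Y|]. rewrite Y, apS.
      rewrite (proj1 LC), <- KBC, CB', EB', EC. vec. }
  assert (PT1 : Defs.nonneg T1).
  { intros x [h ->]. fold (ri (ap T1 (r h)) (r h)). rewrite apT. autorewrite with ri. specialize (Nr h). lra. }
  assert (PS1 : Defs.nonneg S1).
  { intros x [h ->]. fold (ri (ap S1 (B h)) (B h)). rewrite apS, <- ED', <- SD, <- KCD. apply PC. }
  exists T1, S1. split; [split; assumption|split; [|split; [|split; [|split]]]].
  (* A bounded [T1] would have all of [H] as domain, so [M] would contain dom T; [M_dom] would then
     reduce dom T to zero and make [T] bounded. *)
  - intro Bd. apply TU. exists 0. intros x Dx.
    destruct (bounded_sa_total H T1 HC ST1 Bd x) as [h Eh].
    assert (R0 : R h = vzero).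
    { apply M_dom; [apply HR|]. fold (r h). rewrite <- Eh. exact Dx. }
    assert (x0 : x = vscal (mkC 0 0) x).
    { rewrite Eh at 1. unfold r. rewrite R0. change (val vzero) with (vzero : H). vec. }
    rewrite x0, ap_scal, vnorm_scal, Rabs_R0 by (assumption || apply HT). lra.
  - split; [split; assumption|split].
    + intro x. split.
      * intros [h ->]. rewrite <- EB', apS. split; [exists (B h); reflexivity|].
        rewrite <- KBC. exists (C h). reflexivity.
      * intros [[y ->] [z E]]. rewrite apS in E. exists (B y +v C z).
        rewrite <- EB'. f_equal. rewrite (proj1 LB), EB', KBC, <- E, EC. vec.
    + intros x [h ->]. rewrite apT, <- EB', apS, <- KBC, apS, EC, EB'. reflexivity.
  - intro x. split.
    + intros [y ->]. destruct (BM y) as [m [Mm [E _]]]. exists m. split; assumption.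
    + intros [m [Mm <-]]. apply MB, Mm.
  - intros g [y ->]. rewrite apS. destruct (BM y) as [m [Mm [E I]]].
    apply vnorm_eq; [apply vnorm_pos|]. rewrite vnorm_sq, SC, EC.
    rewrite ri_form, E in I. autorewrite with ri. rewrite <- EB', <- SB. lra.
  (* The projection [p] of [q] on [M] is form-orthogonal to every [R h], so [val p] is orthogonal to
     every [h] in [H]. *)
  - intros q Hq. destruct (projection X M q XC SM CM) as [p [Mp Op]].
    assert (p0 : p = vzero).
    { apply (val_inj H S LS), vext. intro h. change (val vzero) with (vzero : H).
      rewrite ri_zero_l, ri_sym, <- (proj2 (HR h)), ri_sym by assumption.
      specialize (Hq (R h) (ex_intro _ h eq_refl)). specialize (Op (R h) (proj1 (HR h))).
      autorewrite with ri in Op. lra. }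
    replace q with (q -v p) by (rewrite p0; vec). exact Op.
Qed.
End Subspace.

(** Otherwise (T x, y) = (S x, S y) <= c^2 |x| |y| for x, y in dom T, and density of dom T would
    bound [T]. *)
Lemma form_norm_unbounded c : exists x : X, dom T (val x) /\ c * vnorm (val x) < vnorm x.
Proof.
  apply NNPP. intro N. apply TU.
  assert (B : forall x, dom T x -> vnorm (ap S x) <= Rabs c * vnorm x).
  { intros x Dx. assert (Sx : dom S x) by (apply HS, Dx).
    set (x' := exist _ x Sx : X).
    assert (K : vnorm x' <= c * vnorm x).
    { apply Rnot_lt_le. intro L. apply N. exists x'. split; assumption. }
    pose proof (vnorm_ap H S LS x' : vnorm (ap S x) <= vnorm x'). pose proof (Rle_abs c).
    pose proof (vnorm_pos H x). nra. }
  exists (Rabs c * Rabs c). intros x Dx. pose proof (Rabs_pos c). pose proof (vnorm_pos H x).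
  apply (dense_bound H (dom T)); [apply HT|apply Rmult_le_pos; nra|].
  intros y Dy. rewrite <- sqrt_form by (assumption || apply HS, Dy).
  pose proof (cauchy_schwarz H (ap S x) (ap S y)). pose proof (B x Dx). pose proof (B y Dy).
  pose proof (vnorm_pos H (ap S x)). pose proof (vnorm_pos H (ap S y)). pose proof (vnorm_pos H y).
  apply Rle_trans with ((Rabs c * vnorm x) * (Rabs c * vnorm y)); nra.
Qed.

(** The total sequence is the image under (1+T)^{-1} of a dense sequence of [H]: being
    form-orthogonal to it means being orthogonal in [H] to the dense sequence. *)
Lemma form_subspaces : separable H -> exists M : nat -> X -> Prop,
  (forall n, subsp (M n) /\ closed (M n) /\
     (forall x, M n x -> dom T (val x) -> x = vzero) /\
     (forall x, orth (M n) x -> dom T (val x) -> x = vzero)) /\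
  (forall n m, n <> m -> exists k l, M n k /\ orth (M m) l /\ ri k l <> 0).
Proof.
  intros [dn Hdn]. destruct form_resolvent as [A HA].
  apply (transversal_subspaces X (fun x => dom T (val x)) (fun x => vnorm (val x))
    (form_space_complete H S LS HC SA)) with (d := fun n => A (dn n)).
  - pose proof (dom_subsp H T (sa_lin H T (proj1 HT))) as [Z [P Q]]. split; [exact Z|split].
    + intros x y. apply P.
    + intros c x. apply Q.
  - intro. apply vnorm_pos.
  - intros. apply vnorm_sub.
  - intros. apply vnorm_scal.
  - intro. apply vnorm_val.
  - intros d Dd. exists (vnorm (val d +v ap T (val d))). split; [apply vnorm_pos|].
    intro x. replace (ri x d) with (ri (val d +v ap T (val d)) (val x)); [apply cauchy_schwarz_abs|].
    rewrite (ri_sym X x d), ri_form, sqrt_form by (assumption || apply val_dom). autorewrite with ri. ring.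
  - exact form_norm_unbounded.
  - intro. apply HA.
  - intros x Hx. apply (val_inj H S LS). apply (dense_ext H _ _ _ Hdn).
    intros w [n ->]. change (val vzero) with (vzero : H).
    rewrite ri_zero_l, ri_sym, <- (proj2 (proj2 (HA (dn n)))), ri_sym. apply Hx.
Qed.

End Restriction.

(** * Infinitely many pairs from the family of subspaces *)

Theorem theorem3p20 :
  forall (H : PreHilbert),
    complete H -> separable H -> infinite_dimensional H ->
  forall (T S : op H),
    nonneg_self_adjoint T -> unbounded T -> is_sqrt S T ->
  exists (T1 T2 S1 S2 : nat -> op H),
    (* infinitely many pairwise distinct pairs <T1 n, T2 n> *)
    (forall n m, n <> m -> ~ (op_eq (T1 n) (T1 m) /\ op_eq (T2 n) (T2 m))) /\
    forall n : nat,
      nonneg_self_adjoint (T1 n) /\ unbounded (T1 n) /\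
      nonneg_self_adjoint (T2 n) /\ unbounded (T2 n) /\
      is_sqrt (S1 n) (T1 n) /\ is_sqrt (S2 n) (T2 n) /\
      (* (1) *)
      (forall x, dom (S1 n) x -> dom T x -> x = vzero) /\
      (forall x, dom (S2 n) x -> dom T x -> x = vzero) /\
      (* (2) *)
      (forall g, dom (S1 n) g -> dom S g /\
                 vnorm (ap (S1 n) g) = vnorm (ap S g)) /\
      (forall g, dom (S2 n) g -> dom S g /\
                 vnorm (ap (S2 n) g) = vnorm (ap S g)) /\
      (* (3) *)
      (forall x, dom (S1 n) x -> dom (S2 n) x -> x = vzero) /\
      (* (4) direct sum and orthogonality w.r.t. (.,.)_{T^{1/2}} *)
      (forall x, dom S x <->
         exists a b, dom (S1 n) a /\ dom (S2 n) b /\ x = vadd a b) /\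
      (forall a b, dom (S1 n) a -> dom (S2 n) b ->
         Cadd (inner (ap S a) (ap S b)) (inner a b) = C0).
Proof.
  intros H HC Sep _ T S HT TU HS.
  destruct (form_subspaces H T S HC HT TU HS Sep) as [M [HM Dist]].
  set (LS := sa_lin H S (proj1 (proj1 HS))) in *.
  pose proof (form_space_complete H S LS HC (proj1 (proj1 HS))) as XC.
  assert (SO : forall n, subsp (orth (M n))) by (intro; apply orth_subsp, HM).
  assert (OO : forall n x, orth (orth (M n)) x -> M n x).
  { intros n x. apply orth_orth; [exact XC|apply HM|apply HM]. }
  destruct (functional_choice (fun n p => form_restriction H T S HS (M n) (fst p) (snd p))) as [P HP].
  { intro n. destruct (HM n) as [A [B [C E]]].
    destruct (restricted_operator H T S HC HT TU HS (M n) A B C E) as [T1 [S1 R]].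
    exists (T1, S1). exact R. }
  destruct (functional_choice (fun n p => form_restriction H T S HS (orth (M n)) (fst p) (snd p))) as [Q HQ].
  { intro n. destruct (HM n) as [_ [_ [C E]]].
    destruct (restricted_operator H T S HC HT TU HS (orth (M n)) (SO n) (orth_closed _ _)) as [T2 [S2 R]].
    - exact E.
    (* For the complement the two trivial-intersection conditions exchange roles, since the double
       complement lies in [M n]. *)
    - intros x Hx. apply C, OO, Hx.
    - exists (T2, S2). exact R. }
  exists (fun n => fst (P n)), (fun n => fst (Q n)), (fun n => snd (P n)), (fun n => snd (Q n)). split.
  (* If the first operators agreed, dom (T1 n) would lie in [M m], so [l] would be orthogonal to it
     and, by totality, to [M n], against (k, l) <> 0. *)
  - intros n m Hnm [E _]. destruct (Dist n m Hnm) as [k [l [Mk [Ol Z]]]]. apply Z.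
    destruct (HP n) as [_ [_ [_ [_ [_ K]]]]]. destruct (HP m) as [_ [_ [I [D _]]]].
    rewrite ri_sym. apply K; [|exact Mk]. intros x Hx. apply Ol.
    apply E, I, proj1, D in Hx. destruct Hx as [x' [Mx Ex]].
    apply val_inj in Ex. subst. exact Mx.
  - intro n. destruct (HM n) as [SM [CM [C E]]].
    destruct (HP n) as [A1 [U1 [I1 [D1 [N1 _]]]]]. destruct (HQ n) as [A2 [U2 [I2 [D2 [N2 _]]]]].
    repeat (split; [assumption|]). split; [|split; [|split; [|split; [|split; [|split]]]]].
    + intros x Hx Tx. apply D1 in Hx. destruct Hx as [m [Mm <-]]. rewrite (C m Mm Tx). reflexivity.
    + intros x Hx Tx. apply D2 in Hx. destruct Hx as [m [Mm <-]]. rewrite (E m Mm Tx). reflexivity.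
    + intros g Hg. split; [|apply N1, Hg]. apply D1 in Hg. destruct Hg as [m [_ <-]]. apply val_dom.
    + intros g Hg. split; [|apply N2, Hg]. apply D2 in Hg. destruct Hg as [m [_ <-]]. apply val_dom.
    + intros x Hx Hx'. apply D1 in Hx. apply D2 in Hx'.
      destruct Hx as [m [Mm <-]], Hx' as [m' [Om E']]. apply val_inj in E'. subst m'.
      rewrite (ri_def _ m (Om m Mm)). reflexivity.
    + intro x. split.
      * intro Dx. destruct (projection _ (M n) (exist _ x Dx) XC SM CM) as [p [Mp Op]].
        eexists _, _. split; [apply D1; exists p; split; [exact Mp|reflexivity]|].
        split; [apply D2; eexists; split; [exact Op|reflexivity]|].
        change (x = val H S LS p +v (x -v val H S LS p)). vec.
      * intros [a [b [Ha [Hb ->]]]]. apply (dom_subsp H S LS).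
        -- apply D1 in Ha. destruct Ha as [m [_ <-]]. apply val_dom.
        -- apply D2 in Hb. destruct Hb as [m [_ <-]]. apply val_dom.
    + intros a b Ha Hb. apply D1 in Ha. apply D2 in Hb.
      destruct Ha as [m [Mm <-]], Hb as [q [Oq <-]].
      assert (Z : ri m q = 0) by (rewrite ri_sym; apply (Oq m Mm)).
      (* The imaginary part vanishes because [M n] is stable under [J]. *)
      assert (ZJ : ri m (J q) = 0).
      { rewrite ri_sym, ri_J. apply Ropp_eq_0_compat, (Oq (J m)), SM, Mm. }
      change (inner m q = C0). rewrite inner_ri. apply C_ext; [exact Z|exact ZJ].
Qed.
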